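(* Let $G$ be a connected bipartite graph with maximum degree $\Delta\geqslant 3$. Then $R(G)\leqslant\sqrt{\Delta-2}$, unless $G$ is the incidence graph of a projective plane of order $\Delta-1$, in which case $R(G)=\sqrt{\Delta-1}$.
   Context: All graphs are simple. For a graph $G$ of order $n$ with adjacency eigenvalues $\lambda_1\geqslant\cdots\geqslant\lambda_n$, the HL-index is $R(G)=\max\{|\lambda_{\lfloor (n+1)/2\rfloor}|,\ |\lambda_{\lceil (n+1)/2\rceil}|\}$. The incidence graph of a projective plane is the bipartite graph whose two parts are the points and the lines of the plane, a point being adjacent to a line iff it lies on it. *)

(* Defs.v *)
From HB Require Import structures.
From mathcomp Require Import all_boot all_order all_algebra.
Set Implicit Arguments. Unset Strict Implicit. Unset Printing Implicit Defensive.
Import Order.TTheory GRing.Theory Num.Theory.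
Local Open Scope ring_scope.

Definition simple_graph (T : finType) (e : rel T) : Prop :=
  symmetric e /\ irreflexive e.

Definition connected_graph (T : finType) (e : rel T) : Prop :=
  forall x y : T, connect e x y.

Definition bipartite (T : finType) (e : rel T) : Prop :=
  exists f : T -> bool, forall x y, e x y -> f x != f y.

Definition degree (T : finType) (e : rel T) (x : T) : nat := #|[set y | e x y]|.
Definition max_degree (T : finType) (e : rel T) : nat :=
  (\max_(x : T) degree e x)%N.

Definition adj_mx (R : nzRingType) (T : finType) (e : rel T) : 'M[R]_#|T| :=
  \matrix_(i, j) (e (enum_val i) (enum_val j))%:R.

Definition sorted_spectrum (R : rcfType) (n : nat) (A : 'M[R]_n) (s : seq R) : Prop :=
  sorted >=%R s /\ char_poly A = \prod_(x <- s) ('X - x%:P).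

(* HL-index of a sorted eigenvalue list of length n (1-indexed positions
   floor((n+1)/2) and ceil((n+1)/2), shifted to 0-indexing). *)
Definition HL_of (R : rcfType) (n : nat) (s : seq R) : R :=
  Num.max `|nth 0 s ((n.+1)./2).-1| `|nth 0 s ((n.+2)./2).-1|.

(* G (on T with edges e) is (isomorphic to) the incidence graph of a
   projective plane of order q: there is a bipartition into "points"
   (f x = true) and "lines" (f x = false), edges only go between the parts,
   and with incidence = adjacency the axioms of a projective plane of order q
   hold. *)
Definition proj_plane_incidence_graph (T : finType) (e : rel T) (q : nat) : Prop :=
  exists f : T -> bool,
    [/\ (forall x y, e x y -> f x != f y),
        (forall p1 p2, f p1 -> f p2 -> p1 != p2 ->
           #|[set l | ~~ f l & e p1 l && e p2 l]| = 1%N),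
        (forall l1 l2, ~~ f l1 -> ~~ f l2 -> l1 != l2 ->
           #|[set p | f p & e p l1 && e p l2]| = 1%N),
        (exists p : 'I_4 -> T, (forall i, f (p i)) /\ injective p /\
           forall l, ~~ f l -> (#|[set i | e (p i) l]| <= 2)%N)
      &
        (forall l, ~~ f l -> #|[set p | f p & e p l]| = q.+1)].

(* Main.v *)
(* The spectrum of G is symmetric, so R(G) is the least modulus of an eigenvalue.
   If R(G) > sqrt(D - 2), the integral matrix A^2 - (D - 2) I is positive definite:
   all degrees are D or D - 1, two vertices have at most one common neighbour, and
   the matrix is the Gram matrix of vectors of norm 1 or 2 with inner products 0
   and 1. A vertex of degree D - 1 yields a K4 minus an edge in the graph H of pairs
   with a common neighbour, and an explicit vector of norm 0. So G is D-regular
   and H is regular with least eigenvalue > -2. If H were not a disjoint union of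
   cliques it would have a hole; even holes are singular, and an odd hole of length
   g spans g orthonormal half-integral vectors. Bessel's inequality restricts how
   the other vertices attach to the hole; the exceptional attachments (g = 5, 7)
   are excluded by counting, and the remaining ones by the incidence geometry of a
   line through a vertex of the hole that contains none of its neighbours there.
   Thus two points have a joining line, two lines meet, and G comes from a
   projective plane. For a plane of order q the form of A^2 is q|x|^2 plus two
   squares of linear forms, whose common kernel is nonzero. *)
Require Import Defs.
From HB Require Import structures.
From mathcomp Require Import all_boot all_order all_algebra zify ring lra.
From mathcomp Require complex.
Import Order.TTheory GRing.Theory Num.Theory.
Local Open Scope ring_scope.
Set Implicit Arguments.
Unset Strict Implicit.
Unset Printing Implicit Defensive.

(** * Integral bilinear forms and positivity on vectors of given support *)

Section IntegralForms.
Variables (T : finType) (K : T -> T -> int).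
Implicit Types x y : {ffun T -> int}.

Definition bform x y : int := \sum_p \sum_q x p * y q * K p q.

Definition delta (p : T) : {ffun T -> int} := [ffun q => (q == p)%:R].

Definition posdef (A : {set T}) := forall x,
  x != 0 -> (forall p, p \notin A -> x p = 0) -> 0 < bform x x.

Lemma bform_is_additive x : zmod_morphism (bform x).
Proof.
move=> y z; rewrite /bform -sumrB; apply: eq_bigr => p _.
rewrite -sumrB; apply: eq_bigr => q _; rewrite !ffunE; ring.
Qed.

HB.instance Definition _ x :=
  GRing.isZmodMorphism.Build {ffun T -> int} int (bform x) (bform_is_additive x).

Lemma bform_delta p q : bform (delta p) (delta q) = K p q.
Proof.
rewrite /bform (bigD1 p) //= (bigD1 q) //= !ffunE !eqxx !mul1r.
rewrite [X in _ + X + _]big1 => [|i /negPf ni]; last by rewrite !ffunE ni mulr0 mul0r.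
rewrite [X in _ + X]big1 ?addr0 // => i /negPf ni.
by rewrite big1 // => j _; rewrite !ffunE ni !mul0r.
Qed.

Hypothesis K_sym : forall p q, K p q = K q p.

Lemma bformC x y : bform x y = bform y x.
Proof.
rewrite /bform exchange_big; apply: eq_bigr => p _; apply: eq_bigr => q _.
by rewrite K_sym mulrAC mulrC mulrA.
Qed.

Lemma bform_suml I (r : seq I) (P : pred I) (f : I -> {ffun T -> int}) y :
  bform (\sum_(i <- r | P i) f i) y = \sum_(i <- r | P i) bform (f i) y.
Proof. by rewrite bformC raddf_sum; apply: eq_bigr => i _; rewrite bformC. Qed.

Lemma bformMzl x y (n : int) : bform (x *~ n) y = n * bform x y.
Proof. by rewrite bformC raddfMz bformC -mulrzr mulrC intz. Qed.

Lemma bformMzr x y (n : int) : bform x (y *~ n) = n * bform x y.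
Proof. by rewrite bformC bformMzl bformC. Qed.

(** Test vectors enter as explicit lists of weighted points, so that the form unfolds to a finite
    sum; [p] certifies that the vector is nonzero. *)
Lemma posdef_seq (A : {set T}) (l : seq (T * int)) p :
  posdef A -> (forall a, a \in l -> a.1 \in A) ->
  \sum_(a <- l | a.1 == p) a.2 != 0 ->
  0 < \sum_(a <- l) \sum_(b <- l) a.2 * b.2 * K a.1 b.1.
Proof.
move=> posA lA nz; pose x : {ffun T -> int} := \sum_(a <- l) delta a.1 *~ a.2.
have xE q : x q = \sum_(a <- l | a.1 == q) a.2.
  rewrite /x sum_ffunE [RHS]big_mkcond; apply: eq_bigr => a _.
  by rewrite ffunMzE mulrzz ffunE eq_sym; case: eqP => _; rewrite ?mul1r ?mul0r.
have xx : bform x x = \sum_(a <- l) \sum_(b <- l) a.2 * b.2 * K a.1 b.1.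
  rewrite {1}/x bform_suml; apply: eq_bigr => a _.
  rewrite raddf_sum; apply: eq_bigr => b _ /=.
  by rewrite bformMzl bformMzr bform_delta mulrA.
rewrite -xx; apply: posA.
  by apply: contra_neq nz => x0; rewrite -xE x0 ffunE.
move=> q qA; rewrite xE big_seq_cond big1 // => a /andP[/lA aA /eqP aq].
by rewrite aq (negPf qA) in aA.
Qed.

End IntegralForms.
Arguments posdef_seq {T K} K_sym {A} l p.

(** * Cyclic index sets and the arithmetic of small squares *)

Section Cycles.
Variable g : nat.
Implicit Types i : 'I_g.

Lemma iter_ordS_val i k : val (iter k (@ordS g) i) = ((i + k) %% g)%N.
Proof.
elim: k => [|k IHk] /=; first by rewrite addn0 modn_small.
by rewrite IHk -[in LHS]addn1 modnDml addn1 addnS.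
Qed.

Lemma iter_ordS_id i : iter g (@ordS g) i = i.
Proof. by apply: val_inj; rewrite iter_ordS_val /= modnDr modn_small. Qed.

(** The difference [y - z] changes sign at each step, hence equals its own negative after one turn
    of an odd cycle. *)
Lemma odd_cycle_unique (y z : 'I_g -> int) : odd g ->
  (forall i, y i + y (ordS i) = z i + z (ordS i)) -> y =1 z.
Proof.
move=> og yz i.
have alt k : y (iter k (@ordS g) i) - z (iter k (@ordS g) i) = (-1) ^+ k * (y i - z i).
  elim: k => [|k IHk]; first by rewrite mul1r.
  rewrite exprS -mulrA -IHk /=; have := yz (iter k (@ordS g) i); lia.
by have := alt g; rewrite iter_ordS_id -signr_odd og expr1; lia.
Qed.

End Cycles.

Lemma small_sqr (x : int) : x * x < 9 -> -2 <= x <= 2.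
Proof. nia. Qed.

Lemma odd_sqr1 (x : int) : (x %% 2)%Z != 0 -> x * x < 8 -> x * x = 1.
Proof.
move=> o /lt_trans/(_ (isT : 8 < 9 :> int))/small_sqr b.
by have [->|->] : x = 1 \/ x = -1 by lia.
Qed.

Lemma even_sqr4 (x : int) : (x %% 2)%Z = 0 -> x != 0 -> 4 <= x * x.
Proof. nia. Qed.

Lemma even_sum_parity (x y m : int) : x + y = 2 * m -> (y %% 2)%Z = (x %% 2)%Z.
Proof. lia. Qed.

Lemma sqr1P (x : int) : x * x = 1 -> x = 1 \/ x = -1.
Proof. nia. Qed.

(** Each term -1 lowers the sum by 2, and the product records the parity of their number. *)
Lemma sum_sign_mod4 (I : Type) (r : seq I) (z : I -> int) :
  (forall i, z i * z i = 1) ->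
  exists m, \sum_(i <- r) z i = (size r)%:Z - 1 + \prod_(i <- r) z i + 4 * m.
Proof.
move=> z1.
suff [_ ?] : (\prod_(i <- r) z i) * (\prod_(i <- r) z i) = 1 /\
    exists m, \sum_(i <- r) z i = (size r)%:Z - 1 + \prod_(i <- r) z i + 4 * m by [].
elim: r => [|i r [P1 [m IHr]]]; first by rewrite !big_nil; split=> //; exists 0.
rewrite !big_cons mulrACA z1 P1; split=> //; rewrite IHr /=.
have [->|->] := sqr1P P1; have [->|->] := sqr1P (z1 i).
- by exists m; lia.
- by exists m; lia.
- by exists m; lia.
- by exists (m - 1); lia.
Qed.

(** * Attachments to a hole in a positive definite system of vectors of norm 2 *)

Section Holes.
Variables (T : finType) (M : T -> T -> int).
Hypothesis M_sym : forall p q, M p q = M q p.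
Hypothesis M_pos : posdef M setT.
Variables (g : nat) (c : 'I_g -> T).
Hypothesis c_inj : injective c.
Hypothesis M_c : forall j k,
  M (c j) (c k) = (j == k)%:R * 2 + (k == ordS j)%:R + (j == ordS k)%:R.
Hypothesis g_ge4 : (4 <= g)%N.
Implicit Types i j k : 'I_g.
Implicit Types s t : T.

Lemma sum_delta_int (I : finType) (f : I -> int) (a : I) :
  \sum_i f i * (i == a)%:R = f a.
Proof.
rewrite (bigD1 a) //= eqxx mulr1 big1 ?addr0 // => i /negPf->.
by rewrite mulr0.
Qed.

(** On an even cycle the alternating sum of the hole vectors has norm 0: in each row the two
    neighbours cancel the diagonal entry 2. *)
Lemma odd_hole : odd g.
Proof.
apply: contraT => /negPf even_g.
have sgn_S i : (-1) ^+ (ordS i) = - (-1) ^+ i :> int.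
  rewrite -[LHS]signr_odd -[in RHS]signr_odd /=.
  rewrite odd_mod ?even_g //= signrN //.
pose l := [seq (c i, (-1) ^+ i : int) | i <- enum 'I_g].
have sumc (P : pred (T * int)) (f : T * int -> int) :
    \sum_(a <- l | P a) f a = \sum_(i | P (c i, (-1) ^+ i)) f (c i, (-1) ^+ i).
  by rewrite big_map big_enum_cond; apply: eq_bigl => i; rewrite andTb.
pose o : 'I_g := Ordinal (leq_trans (isT : (0 < 4)%N) g_ge4).
have := posdef_seq M_sym l (c o) M_pos.
rewrite sumc (eq_bigl (pred1 o)) => [|i]; last by rewrite /= (inj_eq c_inj).
rewrite big_pred1_eq /= => /(_ (fun _ _ => in_setT _) isT).
rewrite sumc big1 ?ltxx // => i _ /=; rewrite sumc /=.
rewrite (eq_bigr (fun j : 'I_g => (-1) ^+ i * 2 * (-1) ^+ j * (j == i)%:R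
  + (-1) ^+ i * (-1) ^+ j * (j == ordS i)%:R
  + (-1) ^+ i * (-1) ^+ j * (j == ord_pred i)%:R)).
  rewrite !big_split /= !sum_delta_int sgn_S.
  have := sgn_S (ord_pred i); rewrite ord_predK => ->; ring.
move=> j _; rewrite M_c (eq_sym i j).
have -> : (i == ordS j) = (j == ord_pred i).
  by apply/eqP/eqP => [->|->]; rewrite ?ordSK ?ord_predK.
ring.
Qed.

(* For odd g the halves f_i of these vectors are orthonormal and c_i = f_i + f_(i+1). *)
Definition alternating i : {ffun T -> int} :=
  \sum_(0 <= k < g) delta (c (iter k (@ordS g) i)) *~ ((-1) ^+ k).

Lemma alternatingD i : alternating i + alternating (ordS i) = delta (c i) *~ 2.
Proof.
rewrite /alternating -big_split /=.
rewrite (eq_big_nat _ _ (F2 := fun k : nat =>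
   - (delta (c (iter k.+1 (@ordS g) i)) *~ ((-1) ^+ k.+1))
   - - (delta (c (iter k (@ordS g) i)) *~ ((-1) ^+ k)))); last first.
  move=> k _; rewrite -iterSr exprS mulN1r mulrNz !opprK addrC //.
rewrite telescope_sumr // iter_ordS_id -signr_odd odd_hole /= expr1 expr0.
by rewrite mulrN1z !opprK.
Qed.

Lemma alternating_off i p : p \notin codom c -> alternating i p = 0.
Proof.
move=> pc; rewrite /alternating sum_ffunE big1 // => k _.
rewrite ffunMzE mulrzz ffunE; case: eqP => [pE|_]; last by rewrite mul0r.
by rewrite pE codom_f in pc.
Qed.

(** Twice the inner product of [s] with the unit vector f_i. *)
Definition coef i s : int := bform M (alternating i) (delta s).

Lemma coefD i s : coef i s + coef (ordS i) s = 2 * M (c i) s.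
Proof.
rewrite /coef !(bformC M_sym _ (delta s)) -raddfD alternatingD /= bformMzr //.
by rewrite bform_delta M_sym.
Qed.

Lemma coef_hole i k : coef i (c k) = (i == k)%:R * 2 + (i == ordS k)%:R * 2.
Proof.
move: i; apply: (@odd_cycle_unique g (coef^~ (c k))
  (fun i => (i == k)%:R * 2 + (i == ordS k)%:R * 2) odd_hole) => j.
rewrite coefD M_c (inj_eq (@ordS_inj g)) (eq_sym (ordS j) k); ring.
Qed.

Lemma bform_alternating i j :
  bform M (alternating i) (alternating j) = (i == j)%:R * 4.
Proof.
move: j; apply: (@odd_cycle_unique g (fun j => bform M (alternating i) (alternating j))
  (fun j => (i == j)%:R * 4) odd_hole) => {}j.
rewrite -raddfD alternatingD /= bformMzr //.
rewrite -/(coef i (c j)) coef_hole; ring.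
Qed.

Definition residual s t : int := 4 * M s t - \sum_i coef i s * coef i t.

Lemma residual_sym s t : residual s t = residual t s.
Proof.
by rewrite /residual M_sym; congr (_ - _); apply: eq_bigr => i _; rewrite mulrC.
Qed.

(* Bessel's inequality: [residual] is 4 times the form of the orthogonal
   projections onto the complement of the alternating vectors. *)
Lemma residual_posdef : posdef residual [set s | s \notin codom c].
Proof.
move=> x nz xc.
pose X i := bform M (alternating i) x.
pose v := x *~ 4 - \sum_i alternating i *~ X i.
have xE : x = \sum_s delta s *~ x s.
  apply/ffunP => s; rewrite sum_ffunE (bigD1 s) //= ffunMzE mulrzz ffunE eqxx mul1r.
  rewrite big1 ?addr0 // => t /negPf ts.
  by rewrite ffunMzE mulrzz ffunE eq_sym ts mul0r.
have XE i : X i = \sum_s x s * coef i s.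
  rewrite /X {1}xE raddf_sum; apply: eq_bigr => s _; exact: bformMzr.
have orth i : bform M v (alternating i) = 0.
  rewrite bformC // /v raddfB /= bformMzr // -/(X i).
  rewrite (raddf_sum (bform M (alternating i))) /=.
  rewrite (eq_bigr (fun j => 4 * X j * (j == i)%:R)) => [|j _].
    by rewrite sum_delta_int subrr.
  by rewrite bformMzr // bform_alternating eq_sym; ring.
have vv : bform M v v = 4 * bform residual x x.
  rewrite {2}/v raddfB /= bformMzr //.
  rewrite (raddf_sum (bform M v)) /= big1 => [|j _]; last first.
    by rewrite bformMzr // orth mulr0.
  rewrite subr0 bformC // /v raddfB /= bformMzr //.
  rewrite (raddf_sum (bform M x)) /=.
  congr (4 * _); rewrite [bform residual x x]/bform.
  rewrite [RHS](eq_bigr (fun p => \sum_q (4 * (x p * x q * M p q) -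
     \sum_i (x p * coef i p) * (x q * coef i q)))) => [|p _]; last first.
    apply: eq_bigr => q _; rewrite /residual mulrBr mulr_sumr; congr (_ - _).
      by ring.
    by apply: eq_bigr => i _; ring.
  rewrite (eq_bigr (fun i => X i * X i)) => [|i _]; last first.
    by rewrite bformMzr // (bformC M_sym x).
  under [RHS]eq_bigr do rewrite sumrB.
  rewrite sumrB; congr (_ - _).
    by rewrite /bform mulr_sumr; apply: eq_bigr => p _; rewrite mulr_sumr.
  rewrite (eq_bigr (fun i => \sum_p \sum_q (x p * coef i p) * (x q * coef i q))).
    rewrite exchange_big; apply: eq_bigr => p _; exact: exchange_big.
  move=> i _; rewrite XE mulr_suml; apply: eq_bigr => p _.
  by rewrite mulr_sumr.
rewrite -(@pmulr_rgt0 _ 4) // -vv; apply: M_pos => [|p]; last by rewrite inE.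
(* Off the hole [v] is [4 x], and on the hole [x] vanishes by hypothesis. *)
apply: contra_neq nz => v0; apply/ffunP => s; rewrite ffunE.
have [sc|sc] := boolP (s \in codom c); first by apply: xc; rewrite inE negbK.
have : v s = 0 by rewrite v0 ffunE.
rewrite /v ffunE ffunMzE [X in _ + X]ffunE sum_ffunE big1 => [|i _].
  by rewrite mulrzz subr0 => /eqP; rewrite mulf_eq0 orbF => /eqP.
by rewrite ffunMzE alternating_off // mul0rz.
Qed.

Hypothesis M_diag : forall p, M p p = 2.
Hypothesis M_off : forall p q, p != q -> M p q = 0 \/ M p q = 1.

Lemma ordS_ind (P : 'I_g -> Prop) i :
  (forall j, P j -> P (ordS j)) -> P i -> forall k, P k.
Proof.
move=> PS Pi k.
have -> : k = iter (k + (g - i)) (@ordS g) i.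
  apply: val_inj; rewrite iter_ordS_val addnCA subnKC 1?ltnW //.
  by rewrite modnDr modn_small.
by elim: (k + (g - i))%N => //= m; apply: PS.
Qed.

Lemma ordS_neq i : (ordS i == i) = false.
Proof.
apply/eqP => /(congr1 val) /=; have [gi|] := eqVneq i.+1 g.
  by rewrite gi modnn; lia.
by move=> gi; rewrite modn_small; have := ltn_ord i; lia.
Qed.

Lemma residual_seq (l : seq (T * int)) s :
  (forall a, a \in l -> a.1 \notin codom c) -> \sum_(a <- l | a.1 == s) a.2 != 0 ->
  0 < \sum_(a <- l) \sum_(b <- l) a.2 * b.2 * residual a.1 b.1.
Proof.
move=> lc; apply: (posdef_seq residual_sym l s residual_posdef) => a /lc.
by rewrite inE.
Qed.

Lemma coef_sqr_lt8 s : s \notin codom c -> \sum_i coef i s * coef i s < 8.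
Proof.
move=> sc; have := @residual_seq [:: (s, 1)] s.
rewrite !big_cons !big_nil /= eqxx /residual M_diag => /(_ _ isT) H.
have : forall a, a \in [:: (s, 1 : int)] -> a.1 \notin codom c.
  by move=> a; rewrite !inE => /eqP->.
by move/H; rewrite !mul1r !addr0 subr_gt0.
Qed.

Lemma residual_pair s t (a b : int) : s \notin codom c -> t \notin codom c ->
  s != t -> a != 0 ->
  0 < a * a * residual s s + 2 * a * b * residual s t + b * b * residual t t.
Proof.
move=> sc tc st a0.
have := @residual_seq [:: (s, a); (t, b)] s.
rewrite !big_cons !big_nil /= eqxx (eq_sym t) (negPf st) !addr0 => H.
have := H _ a0; rewrite (residual_sym t s) => H'.
have -> : a * a * residual s s + 2 * a * b * residual s t + b * b * residual t t =
  a * a * residual s s + a * b * residual s t +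
     (b * a * residual s t + b * b * residual t t) by ring.
by apply: H' => x; rewrite !inE => /orP[] /eqP->.
Qed.

(** The vector [s] has inner product 1 with f_i and 0 with the other f_k; on the hole it is then
    joined to c_i and c_(i-1) only. *)
Definition typed i s := forall k, coef k s = (k == i)%:R * 2.

(** Consecutive coefficients have an even sum, so all have the same parity, and their squares add up
    to less than 8. Odd ones are therefore all 1 or -1, and fewer than 8; among even ones at most
    one is nonzero, with square 4. *)
Lemma coef_cases s : s \notin codom c ->
  [\/ forall k, coef k s = 0, exists i, typed i s |
      (forall k, coef k s * coef k s = 1) /\ (g < 8)%N].
Proof.
move=> sc; have lt8 := coef_sqr_lt8 sc.
have sq_ge0 (k : 'I_g) : 0 <= coef k s * coef k s by rewrite -expr2 sqr_ge0.
have le1 k : coef k s * coef k s < 8.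
  apply: le_lt_trans lt8; rewrite (bigD1 k) //= lerDl.
  by apply: sumr_ge0 => *; apply: sq_ge0.
have le2 k j : k != j -> coef k s * coef k s + coef j s * coef j s < 8.
  move=> kj; apply: le_lt_trans lt8; rewrite (bigD1 k) //= (bigD1 j) 1?eq_sym //=.
  by rewrite addrA lerDl; apply: sumr_ge0 => *; apply: sq_ge0.
pose o : 'I_g := Ordinal (leq_trans (isT : (0 < 4)%N) g_ge4).
have par k : (coef k s %% 2)%Z = (coef o s %% 2)%Z.
  move: k; apply: (@ordS_ind (fun k => (coef k s %% 2)%Z = (coef o s %% 2)%Z) o) => [j|].
    have h := even_sum_parity (coefD j s).
    move=> pj.
    apply: etrans pj.
    exact h.
  by [].
have [oe|oo] := eqVneq (coef o s %% 2)%Z 0; last first.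
  have sq1 k : coef k s * coef k s = 1.
    by apply: odd_sqr1 (le1 k); rewrite par.
  constructor 3; split=> //; have : \sum_(i < g) 1 < 8 :> int.
    by rewrite -(eq_bigr _ (fun k _ => sq1 k)).
  by rewrite sumr_const card_ord; lia.
have ev k : (coef k s %% 2)%Z = 0 by rewrite par.
case: (pickP (fun i => coef i s != 0)) => [i i0|z]; last first.
  by constructor 1 => k; apply/eqP/negbFE/z.
constructor 2; exists i.
have z k : k != i -> coef k s = 0.
  move=> /le2; have := even_sqr4 (ev i) i0; have [//|k0] := eqVneq (coef k s) 0.
  have := even_sqr4 (ev k) k0; lia.
move=> k; have [->|/z->] := eqVneq k i; last by rewrite mul0r.
(* The coefficient at [ordS i] is 0, so the one at [i] is twice an entry 0 or 1; this rules out
   -2. *)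
have := z _ (negbT (ordS_neq i)); have := coefD i s.
have /M_off : c i != s by apply: contraNneq sc => <-; apply: codom_f.
have := ev i; have /small_sqr := lt_trans (le1 i) (isT : 8 < 9 :> int).
move: i0; lia.
Qed.

Lemma typed_hole i s k : typed i s ->
  M (c k) s = (k == i)%:R + (ordS k == i)%:R.
Proof. by move=> ti; have := coefD k s; rewrite !ti; lia. Qed.

Lemma residual_typed i s : typed i s -> residual s s = 4.
Proof.
move=> ti; rewrite /residual M_diag.
rewrite (eq_bigr (fun k => 4 * (k == i)%:R)) => [|k _]; first by rewrite sum_delta_int.
by rewrite ti; case: (k == i).
Qed.

Lemma residual_odd s : (forall k, coef k s * coef k s = 1) -> residual s s = 8 - g%:Z.
Proof.
move=> o; rewrite /residual M_diag (eq_bigr _ (fun k _ => o k)).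
rewrite sumr_const card_ord natz; lia.
Qed.

Lemma residual_typedr i s t : typed i t ->
  residual s t = 4 * M s t - 2 * coef i s.
Proof.
move=> ti; rewrite /residual (eq_bigr (fun k => 2 * coef k s * (k == i)%:R)).
  by rewrite sum_delta_int.
by move=> k _; rewrite ti; ring.
Qed.

(** The value is a multiple of 4, and positivity at [s + t] and [s - t] puts it strictly between -4
    and 4. *)
Lemma typed_typed i j s t : s \notin codom c -> t \notin codom c -> s != t ->
  typed i s -> typed j t -> residual s t = 0.
Proof.
move=> sc tc st si tj.
have := @residual_pair s t 1 1 sc tc st isT.
have := @residual_pair s t 1 (-1) sc tc st isT.
rewrite (residual_typed si) (residual_typed tj) (residual_typedr _ tj) si.
by case: (j == i) => /=; lia.
Qed.

Lemma typed_adj i j s t : s \notin codom c -> t \notin codom c -> s != t ->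
  typed i s -> typed j t -> M s t = (i == j)%:R.
Proof.
move=> sc tc st si tj; have := typed_typed sc tc st si tj.
by rewrite (residual_typedr _ tj) si eq_sym; lia.
Qed.

(** Named after the parity of the coefficients; vertices off the hole whose coefficients are all 0
    belong to neither [evens] nor [odds]. *)
Definition evens := [set s | (s \notin codom c) &&
  [exists i, [forall k, coef k s == (k == i)%:R * 2]]].
Definition odds := [set s | (s \notin codom c) &&
  [forall k, coef k s * coef k s == 1]].

Lemma evensP s : reflect (s \notin codom c /\ exists i, typed i s) (s \in evens).
Proof.
rewrite inE; apply: (iffP andP) => -[sc].
  by case/existsP=> i /forallP ti; split=> //; exists i => k; apply/eqP.
by case=> i ti; split=> //; apply/existsP; exists i; apply/forallP=> k; apply/eqP.
Qed.

Lemma oddsP s : reflect (s \notin codom c /\ forall k, coef k s * coef k s = 1)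
  (s \in odds).
Proof.
rewrite inE; apply: (iffP andP) => -[sc o]; split=> //.
  by move=> k; apply/eqP/(forallP o).
by apply/forallP => k; apply/eqP.
Qed.

Lemma evens_odds_disjoint s : s \in evens -> s \in odds -> False.
Proof.
move=> /evensP[_ [i ti]] /oddsP[_ /(_ (ordS i))].
by rewrite ti ordS_neq.
Qed.

Lemma residual_odd_even s t : s \in odds -> t \in evens ->
  residual s t = 2 \/ residual s t = -2.
Proof.
move=> so te; have st : s != t.
  by apply/eqP => st; apply: (evens_odds_disjoint (s := t)) => //; rewrite -st.
case/oddsP: so => sc so; case/evensP: te => tc [i ti].
have := @residual_pair s t 1 1 sc tc st isT.
have := @residual_pair s t 1 (-1) sc tc st isT.
rewrite (residual_odd so) (residual_typed ti) (residual_typedr _ ti).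
by have [-> | ->] := sqr1P (so i); have [-> | ->] := M_off st; lia.
Qed.

(** For [residual] the even vertices are pairwise orthogonal of norm 4. The list [l] is twice the
    part of [s] orthogonal to them, of norm [4 * (8 - g - #|evens|)]. *)
Lemma evens_bound s : s \in odds -> (#|evens| + g < 8)%N.
Proof.
move=> so; have sE : s \notin evens by apply/negP => /evens_odds_disjoint; apply.
have := so; case/oddsP=> sc os.
pose l := (s, 2 : int) :: [seq (t, - ((residual s t) %/ 2)%Z) | t <- enum evens].
have := @residual_seq l s.
have H a : a \in l -> a.1 \notin codom c.
  rewrite !inE => /orP[/eqP->//|/mapP[t]]; rewrite mem_enum => /evensP[tc _] -> //.
move=> /(_ H); rewrite big_cons eqxx big_map big_enum_cond /=.
rewrite big1 => [/(_ isT)|t /andP[tE /eqP ts]]; last by rewrite -ts tE in sE.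
have half t : t \in evens -> residual s t = 2 * (residual s t %/ 2)%Z
   /\ (residual s t %/ 2)%Z * (residual s t %/ 2)%Z = 1.
  by move=> tE; have [-> | ->] := residual_odd_even so tE.
rewrite /l big_cons big_map big_enum /= big_cons big_map big_enum /=.
rewrite (residual_odd os).
rewrite (eq_bigr (fun _ => -4 : int)) => [|t tE]; last first.
  have [] := half t tE; move: (_ %/ 2)%Z => u -> u1.
  by transitivity (- 4 * (u * u)); [ring | rewrite u1].
rewrite [X in _ + X]big1 => [|t tE].
  by rewrite sumr_const; lia.
rewrite big_cons big_map big_enum /= (bigD1 t) //= big1 => [|t' /andP[t'E t't]].
  have [tc [i ti]] := evensP _ tE; rewrite (residual_typed ti) (residual_sym t s).
  have [] := half t tE; move: (_ %/ 2)%Z => u -> u1.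
  by rewrite addr0; transitivity (- 4 * (u * u) + 4 * (u * u)); [ring | rewrite u1].
have [tc [i ti]] := evensP _ tE; have [t'c [i' ti']] := evensP _ t'E.
by rewrite (typed_typed _ _ _ ti ti') ?mulr0 // eq_sym.
Qed.

(* For g = 5 these signs turn the residual Gram matrix of [odds] into 4 I - J. *)
Definition coef_prod s : int := \prod_i coef i s.

(** By [sum_sign_mod4] the value is odd and its residue modulo 4 is known, while positivity keeps
    its modulus below [8 - g]. For g = 7 nothing is left, for g = 5 a single value. *)
Lemma residual_odd_odd s t : s \in odds -> t \in odds -> s != t ->
  g = 5%N /\ residual s t = - (coef_prod s * coef_prod t).
Proof.
move=> /oddsP[sc os] /oddsP[tc ot] st.
have g8 : (g < 8)%N.
  have /(_ s)/(_ sc)[z|[i ti]|[]//] := coef_cases.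
    by have := os (Ordinal (leq_trans (isT : (0 < 4)%N) g_ge4)); rewrite z.
  by have := os (ordS i); rewrite ti ordS_neq.
have z1 i : (coef i s * coef i t) * (coef i s * coef i t) = 1.
  by rewrite mulrACA os ot.
have [m] := sum_sign_mod4 (index_enum 'I_g) z1.
rewrite big_split /= -/(coef_prod s) -/(coef_prod t).
rewrite (_ : size _ = g) => [sum_m|]; last first.
  by rewrite -sum1_size sum1_card card_ord.
have P1 (u : T) : (forall i, coef i u * coef i u = 1) ->
    coef_prod u = 1 \/ coef_prod u = -1.
  move=> o; apply: sqr1P; rewrite -big_split /=.
  by rewrite big1 // => i _; apply: o.
have := @residual_pair s t 1 1 sc tc st isT.
have := @residual_pair s t 1 (-1) sc tc st isT.
rewrite (residual_odd os) (residual_odd ot) /residual sum_m.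
have := odd_hole; have := g_ge4; have [->|->] := M_off st;
  have [->|->] := P1 s os; have [->|->] := P1 t ot; lia.
Qed.

(** For g = 5, weighting the n odd vertices by the signs [coef_prod] gives norm n (4 - n), which
    must be positive. *)
Lemma odds_bound : (#|odds| <= 1)%N \/ g = 5%N /\ (#|odds| <= 3)%N.
Proof.
have [|gt1] := leqP #|odds| 1; first by left.
right; have [s [t [so to st]]] : exists s t, [/\ s \in odds, t \in odds & s != t].
  by case/card_gt1P: gt1 => s [t [so to st]]; exists s, t.
have [g5 _] := residual_odd_odd so to st; split=> //.
have P1 u : u \in odds -> coef_prod u * coef_prod u = 1.
  case/oddsP=> _ o; rewrite -big_split /= big1 // => i _; exact: o.
pose l := [seq (u, coef_prod u) | u <- enum odds].
have := @residual_seq l s.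
have H a : a \in l -> a.1 \notin codom c.
  by case/mapP=> u; rewrite mem_enum => /oddsP[uc _] ->.
move=> /(_ H); rewrite big_map big_enum_cond /= (big_pred1 s) => [|u]; last first.
  by rewrite /= andb_idl // => /eqP->.
have ps0 : coef_prod s != 0 by apply: contra_eq_neq (P1 s so) => ->; rewrite mul0r.
move=> /(_ ps0).
rewrite big_map big_enum /= (eq_bigr (fun _ => 4 - #|odds|%:Z)) => [|u uo].
  rewrite sumr_const -mulr_natr; nia.
rewrite big_map big_enum /= (bigD1 u) //= P1 // residual_odd; last by case/oddsP: uo.
rewrite (eq_bigr (fun _ => -1)) => [|v /andP[vo vu]].
  rewrite (eq_bigl (mem (odds :\ u))) => [|v]; last by rewrite /= !inE andbC.
  by rewrite sumr_const (cardsD1 u odds) uo g5 mulNrn natz; lia.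
have [_ ->] := residual_odd_odd uo vo (negbT (etrans (eq_sym _ _) (negPf vu))).
transitivity (- ((coef_prod u * coef_prod u) * (coef_prod v * coef_prod v))).
  by ring.
by rewrite !P1.
Qed.

Hypothesis M_deg : forall p, 8 <= \sum_q M p q.

(** Summing [coefD] round the cycle counts every coefficient twice, so the entries of [s] along the
    hole have the same sum as its coefficients. *)
Lemma coef_sum_le s : s \notin codom c ->
  \sum_i M (c i) s <= 2 * (s \in evens)%:R + g%:R * (s \in odds)%:R.
Proof.
move=> sc.
have -> : \sum_i M (c i) s = \sum_i coef i s.
  have : \sum_i (coef i s + coef (ordS i) s) = \sum_i 2 * M (c i) s.
    by apply: eq_bigr => i _; exact: coefD.
  have shift : \sum_i coef i s = \sum_i coef (ordS i) s.
    exact: (reindex_inj (@ordS_inj g)).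
  rewrite -mulr_sumr big_split /= -shift.
  by move: (\sum_i coef i s) (\sum_i M (c i) s) => x y; lia.
have [z|[i ti]|[o _]] := coef_cases sc.
- by rewrite big1 // addr_ge0 // mulr_ge0.
- rewrite (eq_bigr (fun k => 2 * (k == i)%:R)) => [|k _]; last by rewrite ti mulrC.
  rewrite sum_delta_int (_ : s \in evens) ?lerDl ?mulr_ge0 //.
  by apply/evensP; split=> //; exists i.
- rewrite [s \in odds](introT (oddsP s)) // mulr1.
  apply: le_trans (_ : \sum_(i < g) 1 <= _).
    by apply: ler_sum => i _; have [->|->] := sqr1P (o i).
  by rewrite sumr_const card_ord lerDr mulr_ge0.
Qed.

(** Double counting of the edges leaving the hole: each row sum is at least 8, of which the hole
    accounts for 2 + 1 + 1. *)
Lemma attached_count : (4 * g <= 2 * #|evens| + g * #|odds|)%N.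
Proof.
have lo : \sum_i \sum_(s | s \notin codom c) M (c i) s >= 4 * g%:Z.
  rewrite (_ : 4 * g%:Z = \sum_(i < g) 4); last first.
    by rewrite sumr_const card_ord -[RHS]mulr_natr (natz g).
  apply: ler_sum => i _; have := M_deg (c i).
  have sum4 : \sum_(s in codom c) M (c i) s = 4.
    rewrite (eq_bigl (mem [set c k | k in 'I_g])) => [|s]; last first.
      by apply/codomP/imsetP => [[k ->]|[k _ ->]]; exists k.
    rewrite big_imset /= => [|j k _ _ /c_inj //].
    rewrite (eq_bigr (fun k => 2 * (k == i)%:R + 1 * (k == ordS i)%:R
      + 1 * (k == ord_pred i)%:R)) => [|k _].
      by rewrite !big_split /= !sum_delta_int.
    rewrite M_c (eq_sym i k) (_ : (i == ordS k) = (k == ord_pred i)); first by ring.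
    by apply/eqP/eqP => [->|->]; rewrite ?ordSK ?ord_predK.
  by rewrite (bigID (mem (codom c))) /= sum4 -lerBlDl.
have hi : \sum_i \sum_(s | s \notin codom c) M (c i) s <=
    2 * #|evens|%:Z + g%:Z * #|odds|%:Z.
  rewrite exchange_big /=; apply: le_trans (ler_sum _ (fun s sc => coef_sum_le sc)) _.
  rewrite big_split /= -!mulr_sumr (natz g); apply: lerD; apply: ler_wpM2l => //.
    rewrite -natz -sum1_card natr_sum big_mkcond [leRHS]big_mkcond.
    by apply: ler_sum => s _; case: ifP; case: ifP.
  rewrite -natz -sum1_card natr_sum big_mkcond [leRHS]big_mkcond.
  by apply: ler_sum => s _; case: ifP; case: ifP.
lia.
Qed.

(** An odd vertex leaves at most 7 - g even ones. The edge count then gives 5 g <= 14 if it is the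
    only odd one, and 20 <= 19 if there are up to three and g = 5. *)
Lemma odds_eq0 : odds = set0.
Proof.
apply/setP => s; rewrite in_set0; apply/negbTE/negP => so.
have gt0 : (0 < #|odds|)%N by apply/card_gt0P; exists s.
have := evens_bound so; have := attached_count; have := g_ge4; have := odd_hole.
have [] := odds_bound => [|[->]]; nia.
Qed.

Lemma adj_hole_typed s k : s \notin codom c -> M (c k) s = 1 ->
  typed k s \/ typed (ordS k) s.
Proof.
move=> sc Mks; have [z|[i ti]|[o _]] := coef_cases sc.
- by have := coefD k s; rewrite !z Mks.
- have := typed_hole k ti; rewrite Mks; case: eqP => [->|_]; first by left.
  by case: eqP => [->|//]; right.
- by have : s \in odds by [apply/oddsP]; rewrite odds_eq0 inE.
Qed.
End Holes.

(** * Induced paths and holes in regular graphs *)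

Section InducedCycles.
Variables (T : finType) (h : rel T).
Hypotheses (h_sym : symmetric h) (h_irr : irreflexive h).

Definition induced_path n (p : nat -> T) := forall i j, (i < j < n)%N ->
  p i != p j /\ h (p i) (p j) = (j == i.+1).

Definition hole g (c : 'I_g -> T) := injective c /\
  forall j k, h (c j) (c k) = (k == ordS j) || (j == ordS k).

Lemma val_ordS_if g (i : 'I_g) :
  val (ordS i) = if i.+1 == g then 0%N else i.+1.
Proof.
rewrite /=; case: eqP => [->|gi]; first by rewrite modnn.
by rewrite modn_small //; have := ltn_ord i; lia.
Qed.

Lemma hole_of_closed_path g (q : nat -> T) : (3 <= g)%N ->
  (forall i j, (i < j < g)%N -> q i != q j /\
     h (q i) (q j) = (j == i.+1) || (i == 0%N) && (j.+1 == g)) ->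
  hole (fun i : 'I_g => q i).
Proof.
move=> g3 qP; split=> [i j|j k].
  case: (ltngtP i j) => [ij|ji|/val_inj //] /eqP.
    by have [/negPf->] := qP i j (introT andP (conj ij (ltn_ord j))).
  by rewrite eq_sym; have [/negPf->] := qP j i (introT andP (conj ji (ltn_ord i))).
rewrite -!val_eqE !val_ordS_if /=; have := ltn_ord j; have := ltn_ord k.
case: (ltngtP j k) => jk lk lj.
- have [_ ->] := qP j k (introT andP (conj jk lk)).
  by apply/idP/idP; case: ifP; case: ifP; lia.
- rewrite h_sym; have [_ ->] := qP k j (introT andP (conj jk lj)).
  by apply/idP/idP; case: ifP; case: ifP; lia.
- by rewrite jk h_irr; apply/esym/negbTE; case: ifP; lia.
Qed.

Hypothesis h_regular : forall p q, #|[set x | h p x]| = #|[set x | h q x]|.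

(** Otherwise the neighbours of [v] other than [w] all lie among those of [w] other than [v] and
    [t], and [w] has the larger degree. *)
Lemma private_neighbour v w t : h v w -> h w t -> v != t -> ~~ h v t ->
  exists x, [/\ h v x, x != w & ~~ h x w].
Proof.
move=> vw wt vt nvt.
case: (pickP (fun x => [&& h v x, x != w & ~~ h x w])) => [x /and3P[]|none].
  by exists x.
have sub : [set x | h v x] :\ w \subset ([set x | h w x] :\ v) :\ t.
  apply/subsetP => x; rewrite !inE => /andP[xw vx].
  have := none x; rewrite vx xw h_sym /= => /negbFE->; rewrite andbT.
  by apply/andP; split; apply: contraTneq vx => ->; rewrite ?h_irr.
have := subset_leq_card sub.
have := cardsD1 w [set x | h v x]; have := cardsD1 v [set x | h w x].
have := cardsD1 t ([set x | h w x] :\ v).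
by rewrite !inE vw wt (h_sym w) vw (eq_sym t) vt (h_regular v w) /=; lia.
Qed.

(* In a longest induced path v, w, t, ... of a graph without holes every neighbour
   of v is equal or adjacent to w, while t is a neighbour of w only: this
   contradicts regularity. *)
Lemma exists_hole v w t : h v w -> h w t -> v != t -> ~~ h v t ->
  exists g (c : 'I_g -> T), (4 <= g)%N /\ hole c.
Proof.
move=> vw wt vt nvt.
(* Induced paths grow until a hole appears; one with more than [#|T|] vertices is impossible. *)
suff ext n : (exists g (c : 'I_g -> T), (4 <= g)%N /\ hole c) \/
    exists p, induced_path (3 + n) p.
  case: (ext #|T|) => // -[p pP].
  have : injective (fun i : 'I_(3 + #|T|) => p i).
    move=> i j; case: (ltngtP i j) => [ij|ji|/val_inj //] /eqP.
      by have [/negPf->] := pP i j (introT andP (conj ij (ltn_ord j))).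
    by rewrite eq_sym; have [/negPf->] := pP j i (introT andP (conj ji (ltn_ord i))).
  by move/leq_card; rewrite card_ord; lia.
elim: n => [|n [|[p pP]]]; [right | by left | ].
  exists (fun i => if i is 0 then v else if i is 1 then w else t) => i j.
  have ne a b : h a b -> a != b.
    by move=> ab; apply: contraTneq ab => ->; rewrite h_irr.
  case: i => [|[|[|i]]]; case: j => [|[|[|j]]] //=; rewrite ?andbF // => _.
  - by rewrite vw (ne v w vw).
  - by rewrite (negPf nvt).
  - by rewrite wt (ne w t wt).
have [||||x [vx xw nxw]] := @private_neighbour (p 0%N) (p 1%N) (p 2%N).
- by have [//|_ ->] := pP 0%N 1%N.
- by have [//|_ ->] := pP 1%N 2%N.
- by have [] := pP 0%N 2%N.
- by have [//|_ ->] := pP 0%N 2%N.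
have xp i : (i < 3 + n)%N -> x != p i.
  case: i => [|[|i]] // lti; first by apply: contraTneq vx => ->; rewrite h_irr.
  apply: contraTneq vx => ->.
  by have [|_ ->] := pP 0%N i.+2; [lia |].
(* The path is extended at its front by [x]. *)
pose q i := if i is j.+1 then p j else x.
have [none|] := boolP [forall j : 'I_(3 + n), (2 <= j)%N ==> ~~ h x (p j)].
  right; exists q => -[|i] [|[|j]] // ltj.
  - by split; [apply: xp | rewrite /= h_sym vx].
  - split; first by apply: xp; lia.
    have ltj' : (j.+1 < 3 + n)%N by lia.
    have := forallP none (Ordinal ltj') => /=.
    by case: j {ltj ltj'} => [|j] /=; [rewrite (negPf nxw) | move/negPf].
  - by apply: pP; lia.
rewrite negb_forall => /existsP[j0]; rewrite negb_imply negbK => /andP[j02 xj0].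
have ex : exists j, (2 <= j < 3 + n)%N && h x (p j).
  by exists j0; rewrite j02 ltn_ord.
(* The first [p j] with j >= 2 adjacent to [x] closes the hole x, p 0, ..., p j of length j + 2. *)
case: (ex_minnP ex) => j /andP[/andP[j2 jn] xj] minj; left.
exists j.+2, (fun i => q i); split; first by lia.
apply: hole_of_closed_path; first by lia.
move=> [|a] [|b] // /andP[ab bj]; last first.
  have [-> ->] : p a != p b /\ h (p a) (p b) = (b == a.+1) by apply: pP; lia.
  by rewrite eqSS orbF.
split; first by apply: xp; lia.
rewrite /= eqSS; case: b ab bj => [|[|b]] _ bj; first by rewrite h_sym vx.
  by rewrite (negPf nxw); lia.
have [->|bj'] := eqVneq b.+2 j; first by rewrite xj; lia.
have [bx|] := boolP (h x (p b.+2)); last by move=> _; lia.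
by have := minj b.+2; rewrite bx; lia.
Qed.

End InducedCycles.

Lemma card_gt2_avoid (T : finType) (A : {set T}) a b : (2 < #|A|)%N ->
  exists x, [/\ x \in A, x != a & x != b].
Proof.
move=> A2; have /subsetPn[x xA] : ~~ (A \subset [set a; b]).
  apply: contraL A2 => /subset_leq_card; rewrite cards2 -leqNgt => le.
  by apply: leq_trans le _; case: (a != b).
by rewrite !inE negb_or => /andP[]; exists x.
Qed.

(** * Local structure when A^2 - (D - 2) I is positive definite *)

Section CommonNeighbours.
Variables (T : finType) (e : rel T) (D : nat).
Hypotheses (e_sym : symmetric e) (D_ge3 : (3 <= D)%N).
Hypothesis deg_le : forall p, (degree e p <= D)%N.

Definition common p q := [set u | e p u && e q u].

Definition gram p q : int := #|common p q|%:Z - (p == q)%:R * (D - 2)%N%:Z.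

(** The graph H. Vertices serve both as points and as lines: [e p u] reads as u being a line through
    p. *)
Definition collinear : rel T := [rel p q | (p != q) && [exists u, e p u && e q u]].

Lemma gram_sym p q : gram p q = gram q p.
Proof.
rewrite /gram eq_sym (_ : common p q = common q p) //.
by apply/setP => u; rewrite !inE andbC.
Qed.

Lemma gram_diag p : gram p p = (degree e p)%:Z - (D - 2)%N%:Z.
Proof.
rewrite /gram eqxx mul1r (_ : common p p = [set u | e p u]) //.
by apply/setP => u; rewrite !inE andbb.
Qed.

Hypothesis gram_pos : posdef gram setT.

Lemma gram_diag_cases p : gram p p = 1 /\ degree e p = D.-1 \/
  gram p p = 2 /\ degree e p = D.
Proof.
have := posdef_seq gram_sym [:: (p, 1)] p gram_pos (fun _ _ => in_setT _).
rewrite !big_cons !big_nil /= eqxx => /(_ isT).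
have := deg_le p; rewrite gram_diag; lia.
Qed.

Lemma gram_diag_le2 p : gram p p <= 2.
Proof. by case: (gram_diag_cases p) => -[->]. Qed.

(** The vector [p - q] has norm at most [4 - 2 * gram p q], so positivity leaves only the values 0
    and 1. *)
Lemma gram_off p q : p != q -> gram p q = (collinear p q)%:R.
Proof.
move=> pq; have := posdef_seq gram_sym [:: (p, 1); (q, -1)] p gram_pos (fun _ _ => in_setT _).
rewrite !big_cons !big_nil /= eqxx (eq_sym q) (negPf pq) (gram_sym q p) => /(_ isT).
have -> : collinear p q = (0 < #|common p q|)%N.
  rewrite /collinear /= pq; apply/existsP/card_gt0P => -[u pu]; exists u; first by rewrite inE.
  by rewrite inE in pu.
have -> : gram p q = #|common p q|%:Z by rewrite /gram (negPf pq) mul0r subr0.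
by have := gram_diag_cases p; have := gram_diag_cases q; case: #|_| => [|[|n]]; lia.
Qed.

Lemma short_not_collinear p q : gram p p = 1 -> gram q q = 1 -> ~~ collinear p q.
Proof.
move=> p1 q1; apply/negP => pq; have /andP[npq _] := pq.
have := posdef_seq gram_sym [:: (p, 1); (q, -1)] p gram_pos (fun _ _ => in_setT _).
rewrite !big_cons !big_nil /= eqxx (eq_sym q) (negPf npq) (gram_sym q p) => /(_ isT).
by rewrite p1 q1 gram_off // pq; lia.
Qed.

Lemma collinear_sym : symmetric collinear.
Proof.
move=> p q; rewrite /collinear /= eq_sym; congr (_ && _).
by apply/existsP/existsP => -[u]; rewrite andbC => ?; exists u.
Qed.

Lemma collinear_irr : irreflexive collinear.
Proof. by move=> p; rewrite /collinear /= eqxx. Qed.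

Lemma collinearI p q u : p != q -> e p u -> e q u -> collinear p q.
Proof. by move=> pq pu qu; rewrite /collinear /= pq; apply/existsP; exists u; rewrite pu. Qed.

Lemma common_unique p q u v : p != q -> e p u -> e q u -> e p v -> e q v -> u = v.
Proof.
move=> pq pu qu pv qv.
have /card_le1_eqP : (#|common p q| <= 1)%N.
  by have := gram_off pq; rewrite /gram (negPf pq); case: (collinear p q); lia.
by apply; rewrite inE ?pu ?pv.
Qed.

Definition meeting w l := [set u | e w u && [exists t, e l t && e u t]].

(** Joining [w] to the points of [l] gives different lines: two points of [l] on the same line
    through [w] would make it equal to [l], which misses [w]. *)
Lemma card_meeting w l : ~~ e w l -> (forall t, e l t -> collinear w t) ->
  (degree e l <= #|meeting w l|)%N.
Proof.
move=> wl col; pose f t := odflt t [pick u | e w u && e t u].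
have fP t : e l t -> e w (f t) && e t (f t).
  move=> /col /andP[_ /existsP[u wu]]; rewrite /f.
  by case: pickP => [//|/(_ u)]; rewrite wu.
rewrite /degree -(@card_in_imset _ _ f) => [|t t']; rewrite ?inE.
  apply/subset_leq_card/subsetP => _ /imsetP[t + ->]; rewrite !inE => lt.
  have /andP[-> tf] := fP t lt; apply/existsP; exists t.
  by rewrite lt e_sym.
move=> lt lt' ff; apply/eqP; apply: contraNT wl => tt'.
have /andP[wf tf] := fP t lt; have /andP[_] := fP t' lt'; rewrite -ff => t'f.
by rewrite (@common_unique t t' l (f t)) // e_sym.
Qed.

Lemma card_meeting_le w l : (#|meeting w l| <= degree e w)%N.
Proof. by apply/subset_leq_card/subsetP => u; rewrite !inE => /andP[]. Qed.

Lemma neighbour_other p u : exists2 q, e p q & q != u.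
Proof.
have: (1 < degree e p)%N by have := gram_diag_cases p; lia.
case/card_gt1P => q [q' [+ + qq']]; rewrite !inE => pq pq'.
by have [qu|] := eqVneq q u; [exists q' => //; rewrite -qu eq_sym | exists q].
Qed.

(** The vector [a + b - 2 p] has norm at most [2 * gram a b]. *)
Lemma short_clique p a b : gram p p = 1 -> collinear p a -> collinear p b ->
  a != b -> collinear a b.
Proof.
move=> p1 pa pb ab; have /andP[npa _] := pa; have /andP[npb _] := pb.
have := posdef_seq gram_sym [:: (p, -2); (a, 1); (b, 1)] p gram_pos
   (fun _ _ => in_setT _).
rewrite !big_cons !big_nil /= eqxx !(eq_sym _ p) (negPf npa) (negPf npb) => /(_ isT).
rewrite (gram_sym a p) (gram_sym b p) (gram_sym b a) (gram_off npa) (gram_off npb).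
rewrite (gram_off ab) pa pb p1.
have := gram_diag_cases a; have := gram_diag_cases b.
by case: (collinear a b) => //; lia.
Qed.

(* The four points used in the test vector [2 p - x - w + t] span a K4 minus an edge. *)
Lemma short_no_long_line p x w l : gram p p = 1 -> collinear p x -> collinear p w ->
  x != w -> e x l -> e w l -> ~~ e p l -> degree e l = D -> False.
Proof.
move=> p1 px pw xw xl wl pl lD.
(* If [p] were collinear with all D points of [l], there would be D lines through [p], whose degree
   is D - 1. *)
have [t [lt pt]] : exists t, e l t /\ ~~ collinear p t.
  case: (pickP (fun t => e l t && ~~ collinear p t)) => [t /andP[]|none].
    by exists t.
  have col t : e l t -> collinear p t.
    by move=> lt; have := none t; rewrite lt => /negbFE.
  have := card_meeting pl col; have := card_meeting_le p l.
  by have := gram_diag_cases p; lia.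
have npt : p != t by apply: contraNneq pl => ->; rewrite e_sym.
have tx : t != x by apply: contraNneq pt => ->.
have tw : t != w by apply: contraNneq pt => ->.
have /andP[npx _] := px; have /andP[npw _] := pw.
have := posdef_seq gram_sym [:: (p, 2); (x, -1); (w, -1); (t, 1)] p gram_pos
   (fun _ _ => in_setT _).
rewrite !big_cons !big_nil /= eqxx !(eq_sym _ p).
rewrite (negPf npx) (negPf npw) (negPf npt) => /(_ isT).
rewrite (gram_sym x p) (gram_sym w p) (gram_sym t p) (gram_sym w x).
rewrite (gram_sym x t) (gram_sym w t) (gram_off npx) (gram_off npw) (gram_off npt).
rewrite (gram_off xw) (gram_off tx) (gram_off tw) px pw (negPf pt) p1.
have tl : e t l by rewrite e_sym.
rewrite (collinearI xw xl wl) (collinearI tx tl xl) (collinearI tw tl wl).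
move: (gram x x) (gram w w) (gram t t) (gram_diag_le2 x) (gram_diag_le2 w) (gram_diag_le2 t).
by clear=> a b c; rewrite /= ?mulr0 ?mulr1 ?addr0; lia.
Qed.

(** Suppose [p] has degree D - 1; take lines [u1], [u2] through it and [x] on [u1]. Each further [w]
    on [u2] is joined to [x] by a line missing [p], which must have norm 1. Two choices of [w] give
    two such lines meeting in [x], against [short_not_collinear]. *)
Lemma regular p : degree e p = D.
Proof.
case: (gram_diag_cases p) => [[p1 _]|[]//]; exfalso.
have [u1 pu1 _] := neighbour_other p p.
have [u2 pu2 u21] := neighbour_other p u1.
have [x u1x xp] := neighbour_other u1 p.
have col u y : e p u -> e u y -> y != p -> collinear p y.
  by move=> pu uy yp; apply: (collinearI _ pu); rewrite 1?eq_sym // e_sym.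
have px := col _ _ pu1 u1x xp.
have join w : e u2 w -> w != p ->
  exists l, [/\ e x l, e w l, ~~ e p l & (degree e l = D -> False)] /\ l != u2.
  move=> u2w wp; have pw := col _ _ pu2 u2w wp.
  have xw : x != w.
    apply: contraNneq u21 => xw; rewrite eq_sym in xp.
    by apply/eqP; apply: (common_unique xp) => //; rewrite e_sym // xw.
  have /andP[_ /existsP[l /andP[xl wl]]] := short_clique p1 px pw xw.
  have pl : ~~ e p l.
    apply: contraNN u21 => pl; rewrite eq_sym in xp; rewrite eq_sym in wp.
    have lu1 : l = u1 by apply: (common_unique xp) => //; rewrite e_sym.
    have lu2 : l = u2 by apply: (common_unique wp) => //; rewrite e_sym.
    by rewrite -lu1 -lu2.
  exists l; split; last by apply: contraNneq pl => ->.
  by split=> // lD; apply: (@short_no_long_line p x w l).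
have [w u2w wp] := neighbour_other u2 p.
have [l [[xl wl pl lD] lu2]] := join w u2w wp.
have l1 : gram l l = 1 by case: (gram_diag_cases l) => -[].
(* The line [u2] meets the line [l] of norm 1, so it has norm 2; having D >= 3 points, it contains a
   second choice [w']. *)
have u2D : degree e u2 = D.
  case: (gram_diag_cases u2) => -[] // u1'.
  have /negP[] := short_not_collinear l1 u1'.
  by apply: (collinearI (u := w)); rewrite // e_sym.
have [w' [u2w' w'p w'w]] : exists w', [/\ e u2 w', w' != p & w' != w].
  have gt2 : (2 < #|[set y | e u2 y]|)%N by rewrite -/(degree e u2) u2D.
  have [y []] := card_gt2_avoid p w gt2; rewrite inE => ? ? ?; exists y; split=> //.
have [l' [[xl' wl' pl' lD'] l'u2]] := join w' u2w' w'p.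
have l1' : gram l' l' = 1 by case: (gram_diag_cases l') => -[].
have /negP[] := short_not_collinear l1 l1'.
apply: (collinearI (u := x)); rewrite 1?e_sym //.
apply: contraNneq lu2 => ll'; apply/eqP; apply: (common_unique w'w) => //;
  by rewrite 1?ll' // e_sym.
Qed.

Lemma gram_diag2 p : gram p p = 2.
Proof. by rewrite gram_diag regular; lia. Qed.

(** There are D * D walks of length 2 from [p], and the diagonal term takes away D - 2. *)
Lemma gram_sum p : \sum_q gram p q = (D * D - (D - 2))%N%:Z.
Proof.
have -> : \sum_q gram p q = (\sum_q #|common p q|)%N%:Z - (D - 2)%N%:Z.
  rewrite sumrB -(natz (\sum_q _)%N) natr_sum; congr (_ - _).
    by apply: eq_bigr => q _; rewrite natz.
  rewrite (bigD1 p) //= eqxx mul1r big1 ?addr0 // => q /negPf pq.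
  by rewrite eq_sym pq mul0r.
have -> : (\sum_q #|common p q| = \sum_(u | e p u) degree e u)%N.
  rewrite (eq_bigr (fun q => \sum_(u | e p u) e q u)%N) => [|q _]; last first.
    rewrite -sum1_card big_mkcond [RHS]big_mkcond; apply: eq_bigr => u _.
    by rewrite inE; case: (e p u); case: (e q u).
  rewrite exchange_big; apply: eq_bigr => u _ /=.
  rewrite /degree -sum1_card [RHS]big_mkcond; apply: eq_bigr => q _.
  by rewrite inE e_sym; case: (e u q).
rewrite (eq_bigr (fun _ => D)) => [|u _]; last exact: regular.
rewrite (_ : \sum_(u | e p u) D = D * D)%N; first by nia.
rewrite (eq_bigl (mem [set u | e p u])) => [|u]; last by rewrite /= inE.
by rewrite sum_nat_const -/(degree e p) regular.
Qed.

Lemma collinear_regular p : #|[set q | collinear p q]| = (D * D - D)%N.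
Proof.
have := gram_sum p; rewrite (bigD1 p) //= gram_diag2.
have -> : \sum_(q | q != p) gram p q = #|[set q | collinear p q]|%:Z.
  rewrite -natz -sum1_card natr_sum big_mkcond [RHS]big_mkcond.
  apply: eq_bigr => q _; rewrite inE; have [->|qp] := eqVneq q p.
    by rewrite collinear_irr.
  by rewrite gram_off 1?eq_sym //; case: (collinear p q).
by move=> H; apply/eqP; rewrite -eqz_nat; apply/eqP; move: H; nia.
Qed.

Lemma iter_ordS_neq g (i : 'I_g) m : (0 < m < g)%N -> (iter m (@ordS g) i == i) = false.
Proof.
move=> mg; apply/negbTE/eqP => /(congr1 val); rewrite iter_ordS_val /= => H.
have ig := ltn_ord i; have [le|lt] := leqP g (i + m)%N; last first.
  by move: H; rewrite modn_small //; lia.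
move: H; rewrite -(subnK le) modnDr modn_small; lia.
Qed.

(** The lines through [w] meeting [l] number D, so they are all lines through [w]; the one joining
    [w] to [z] meets [l] in a point equal to or collinear with [z]. *)
Lemma all_lines_meet w l z : ~~ e w l -> (forall t, e l t -> collinear w t) ->
  collinear w z -> (forall t, e l t -> z != t /\ ~~ collinear z t) -> False.
Proof.
move=> wl col /andP[_ /existsP[u /andP[wu zu]]] nz.
have /setP/(_ u) : meeting w l = [set u | e w u].
  apply/eqP; rewrite eqEcard -/(degree e w) regular -(regular l) card_meeting //.
  by rewrite andbT; apply/subsetP => v; rewrite !inE => /andP[].
rewrite !inE wu /= => /existsP[t /andP[lt ut]].
by have [zt /negP[]] := nz t lt; apply: collinearI zt zu _; rewrite e_sym.
Qed.

Section Hole.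
Variables (g : nat) (c : 'I_g -> T).
Hypotheses (g_ge4 : (4 <= g)%N) (c_hole : hole collinear c).

Let c_inj : injective c := c_hole.1.

Lemma gram_hole j k :
  gram (c j) (c k) = (j == k)%:R * 2 + (k == ordS j)%:R + (j == ordS k)%:R.
Proof.
have [<-|jk] := eqVneq j k.
  by rewrite gram_diag2 eq_sym (iter_ordS_neq j (m := 1)) //; lia.
rewrite gram_off ?(inj_eq c_inj) // c_hole.2.
have [kj|_] := eqVneq k (ordS j); last by case: (j == ordS k).
by rewrite kj eq_sym (iter_ordS_neq j (m := 2)) //; lia.
Qed.

Lemma gram_off01 p q : p != q -> gram p q = 0 \/ gram p q = 1.
Proof. by move=> /gram_off->; case: (collinear p q); [right | left]. Qed.

Lemma gram_sum_ge8 p : 8 <= \sum_q gram p q.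
Proof. by rewrite gram_sum; nia. Qed.

Lemma no_hole : False.
Proof.
have h4 := g_ge4.
pose k : 'I_g := Ordinal (leq_trans (isT : (0 < 4)%N) g_ge4).
(* Consecutive positions [k], [b], [i], [d], [f]; for g = 4 the last is the first. *)
pose b := ordS k; pose i := ordS b; pose d := ordS i; pose f := ordS d.
have S1 (j : 'I_g) : (ordS j == j) = false by apply: (iter_ordS_neq j (m := 1)); lia.
have S2 (j : 'I_g) : (ordS (ordS j) == j) = false.
  by apply: (iter_ordS_neq j (m := 2)); lia.
have S3 (j : 'I_g) : (ordS (ordS (ordS j)) == j) = false.
  by apply: (iter_ordS_neq j (m := 3)); lia.
have cc j l : collinear (c j) (c l) = (l == ordS j) || (j == ordS l) := c_hole.2 j l.
(* Of the D >= 3 lines through [c i], only one joins it to each of its two neighbours on the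
   hole. *)
have [u [iu bu du]] : exists u, [/\ e (c i) u, ~~ e (c b) u & ~~ e (c d) u].
  case: (pickP (fun u => [&& e (c i) u, ~~ e (c b) u & ~~ e (c d) u])) => [u /and3P[]|none].
    by exists u.
  have sub : [set u | e (c i) u] \subset common (c i) (c b) :|: common (c i) (c d).
    apply/subsetP => u; rewrite !inE => iu; have := none u; rewrite iu /=.
    by case: (e (c b) u); case: (e (c d) u).
  have := subset_leq_card sub; rewrite -/(degree e (c i)) regular.
  have := cardsU (common (c i) (c b)) (common (c i) (c d)).
  have := gram_hole i b; have := gram_hole i d; rewrite /gram !(inj_eq c_inj).
  rewrite /d (eq_sym i (ordS i)) S1 eqxx (eq_sym i (ordS (ordS i))) S2.
  by rewrite /i S1 (eq_sym b) S2 eqxx; lia.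
have out s : e u s -> s != c i -> s \notin codom c.
  move=> us si; apply/codomP => -[j sj]; move: us si; rewrite sj => uj ji.
  have : collinear (c i) (c j) by apply: (collinearI (u := u)); rewrite 1?eq_sym // e_sym.
  rewrite cc /i => /orP[/eqP jd|/eqP/ordS_inj bj].
    by case/negP: du; rewrite /d /i -jd e_sym.
  by case/negP: bu; rewrite bj e_sym.
have tp s : e u s -> s != c i ->
    typed gram c i s \/ typed gram c d s.
  move=> us si; apply: (adj_hole_typed gram_sym gram_pos c_inj gram_hole g_ge4
    gram_diag2 gram_off01 gram_sum_ge8 (out s us si)).
  rewrite gram_off 1?eq_sym //.
  by rewrite (collinearI (u := u)) // 1?eq_sym // e_sym.
have th := typed_hole gram_sym gram_pos c_inj gram_hole g_ge4.
(* Points of [u] are pairwise collinear, and by [typed_adj] collinear typed vertices have the same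
   type. *)
have same j s t : e u s -> e u t -> s != c i -> t != c i ->
    typed gram c j s -> j = i \/ j = d -> typed gram c j t.
  move=> us ut si ti js jid; have [<-//|st] := eqVneq s t.
  have st1 : gram s t = 1.
    by rewrite gram_off // (collinearI (u := u)) // e_sym.
  have eqj m : typed gram c m t -> j = m.
    move=> mt; have := typed_adj gram_sym gram_pos c_inj gram_hole g_ge4 gram_diag2
      (out s us si) (out t ut ti) st js mt.
    by rewrite st1; case: eqP.
  by case: (tp t ut ti) => jt; rewrite (eqj _ jt).
have [s us si] := neighbour_other u (c i).
have adjc (m : 'I_g) t : t \notin codom c -> gram (c m) t = (collinear (c m) t)%:R.
  by move=> tc; rewrite gram_off //; apply: contraNneq tc => <-; apply: codom_f.
have ne (m : 'I_g) t : t \notin codom c -> c m != t.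
  by move=> tc; apply: contraNneq tc => <-; apply: codom_f.
(* In type [i] all points of [u] are collinear with [c b] and none with [c k], which is itself
   collinear with [c b]. Type [d] is the mirror image, with [c d] and [c f]. *)
case: (tp s us si) => [is_|ds].
  apply: (@all_lines_meet (c b) u (c k)) => // [t ut||t ut].
  - have [->|ti] := eqVneq t (c i); first by rewrite cc eqxx.
    have := th _ _ b (same _ _ _ us ut si ti is_ (or_introl erefl)).
    by rewrite (adjc _ _ (out t ut ti)) eqxx; case: (collinear _ _) => //; case: (b == i).
  - by rewrite cc eqxx orbT.
  - have [->|ti] := eqVneq t (c i).
      by rewrite cc (inj_eq c_inj) /i /b !(eq_sym k) S2 S3 S1.
    split; first exact: ne (out t ut ti).
    have := th _ _ k (same _ _ _ us ut si ti is_ (or_introl erefl)).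
    rewrite (adjc _ _ (out t ut ti)) /i /b !(eq_sym k) S2 (eq_sym (ordS k)) S1.
    by case: (collinear _ _).
apply: (@all_lines_meet (c d) u (c f)) => // [t ut||t ut].
- have [->|ti] := eqVneq t (c i); first by rewrite cc eqxx orbT.
  have := th _ _ d (same _ _ _ us ut si ti ds (or_intror erefl)).
  by rewrite (adjc _ _ (out t ut ti)) eqxx; case: (collinear _ _) => //; case: (_ == _).
- by rewrite cc eqxx.
- have [->|ti] := eqVneq t (c i).
    by rewrite cc (inj_eq c_inj) /f /d S2 !(eq_sym i) S3 S1.
  split; first exact: ne (out t ut ti).
  have := th _ _ f (same _ _ _ us ut si ti ds (or_intror erefl)).
  rewrite (adjc _ _ (out t ut ti)) /f S1 S2.
  by case: (collinear _ _).
Qed.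

End Hole.

Lemma collinear_trans v w t : collinear v w -> collinear w t -> v != t -> collinear v t.
Proof.
move=> vw wt vt; apply: contraT => nvt.
have reg p q : #|[set x | collinear p x]| = #|[set x | collinear q x]|.
  by rewrite !collinear_regular.
have [g [c [g4 ch]]] := exists_hole collinear_sym collinear_irr reg vw wt vt nvt.
by case: (no_hole g4 ch).
Qed.

End CommonNeighbours.

(** * The axioms of a projective plane *)

Section BuildPlane.
Variables (T : finType) (e : rel T) (D : nat) (f : T -> bool).
Hypotheses (e_sym : symmetric e) (D_ge3 : (3 <= D)%N).
Hypothesis deg_le : forall p, (degree e p <= D)%N.
Hypothesis gram_pos : posdef (gram e D) setT.
Hypothesis e_conn : connected_graph e.
Hypothesis e_bip : forall x y, e x y -> f x != f y.

Lemma collinear_same_part p q : collinear e p q -> f p = f q.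
Proof.
case/andP=> _ /existsP[u /andP[/e_bip + /e_bip]].
by case: (f p) (f q) (f u) => [] [] [].
Qed.

(** Along a walk from [p] every vertex is near [p] or adjacent to a vertex near [p], by
    transitivity; the second alternative puts it in the other part. *)
Lemma same_part_collinear p q : f p = f q -> p != q -> collinear e p q.
Proof.
pose near x := (p == x) || collinear e p x.
have nearf x : near x -> f p = f x.
  by case/orP=> [/eqP->//|]; apply: collinear_same_part.
suff reach : near q \/ exists2 u, near u & e u q.
  move=> fpq pq; have [|[u /nearf fpu /e_bip]] := reach; last by rewrite -fpu fpq eqxx.
  by rewrite /near (negPf pq).
have /connectP[s + ->] := e_conn p q.
elim/last_ind: s => [|s x IHs] /=; first by left; rewrite /near eqxx.
rewrite rcons_path last_rcons => /andP[/IHs[nl|[u nu ul]] lx].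
  by right; exists (last p s).
left; rewrite /near; have [//|px /=] := eqVneq p x.
have [ux|ux] := eqVneq u x; first by move: nu; rewrite /near ux (negPf px).
have cux : collinear e u x by apply: collinearI ux ul _; rewrite e_sym.
move: nu => /orP[/eqP->//|pu].
exact: (collinear_trans e_sym D_ge3 deg_le gram_pos pu cux px).
Qed.

Lemma card_common p q : f p = f q -> p != q -> #|common e p q| = 1%N.
Proof.
move=> fpq pq; have := gram_off D_ge3 deg_le gram_pos pq.
rewrite same_part_collinear // /gram (negPf pq) /=; lia.
Qed.

(** The corners are two points on each of two lines [l1], [l2], all different from their
    intersection [o]. A line through three of them contains one of these pairs, so it is [l1] or
    [l2] and misses the other pair. *)
Lemma quadrangle (x0 : T) : exists p : 'I_4 -> T,
  [/\ forall i, f (p i), injective p &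
      forall l, ~~ f l -> (#|[set i | e (p i) l]| <= 2)%N].
Proof.
have deg p : (2 < #|[set y | e p y]|)%N.
  by rewrite -/(degree e p) (regular e_sym D_ge3 deg_le gram_pos).
have three x y z : exists w, [/\ e x w, w != y & w != z].
  by have [w []] := card_gt2_avoid y z (deg x); rewrite inE; exists w.
have [l1 fl1] : exists l, ~~ f l.
  have [y [/e_bip xy _ _]] := three x0 x0 x0.
  by case fx: (f x0) xy; [exists y | exists x0; rewrite fx].
have [o [l1o _ _]] := three l1 l1 l1.
have [l2 [ol2 l21 _]] := three o l1 l1.
have [a [l1a ao _]] := three l1 o o.
have [b [l1b bo ba]] := three l1 o a.
have [c [l2c co _]] := three l2 o o.
have [d [l2d d_o dc]] := three l2 o c.
have fo : f o by move: (e_bip l1o); rewrite (negPf fl1); case: (f o).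
have fl2 : ~~ f l2 by move: (e_bip ol2); rewrite fo; case: (f l2).
have on1 x : e l1 x -> f x by move/e_bip; rewrite (negPf fl1); case: (f x).
have on2 x : e l2 x -> f x by move/e_bip; rewrite (negPf fl2); case: (f x).
have uniqL x y l l' : x != y -> e x l -> e y l -> e l' x -> e l' y -> l = l'.
  move=> xy xl yl; rewrite !(e_sym l') => xl' yl'.
  exact: (common_unique D_ge3 deg_le gram_pos xy).
have l2o : e l2 o by rewrite e_sym.
have x12 x : e l1 x -> e l2 x -> x = o.
  move=> l1x l2x; apply/eqP; apply: contraNT l21 => xo.
  by rewrite (@uniqL x o l2 l1) // e_sym.
have u4 : uniq [:: a; b; c; d].
  rewrite /= !inE !negb_or (eq_sym a b) ba (eq_sym c d) dc /= !andbT.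
  have ne x y : e l1 x -> e l2 y -> x != o -> x != y.
    by move=> l1x l2y xo; apply: contraNneq xo => xy; rewrite (x12 x) // xy.
  by rewrite (ne a c) // (ne a d) // (ne b c) // (ne b d).
exists (fun i : 'I_4 => nth a [:: a; b; c; d] i); split.
- by case=> -[|[|[|[|i]]]] //= _; auto.
- by move=> i j /eqP; rewrite nth_uniq // => /eqP/val_inj.
move=> l fl; rewrite -sum1_card big_mkcond /= !big_ord_recl big_ord0 !inE /=.
have l1ab : e a l -> e b l -> l = l1 by move=> al bl; apply: (uniqL b a).
have l2cd : e c l -> e d l -> l = l2 by move=> cl dl; apply: (uniqL d c).
have off1 x : e l1 x -> x != o -> ~~ e x l2.
  by move=> l1x; apply: contraNN => xl2; rewrite (x12 x) // e_sym.
have off2 x : e l2 x -> x != o -> ~~ e x l1.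
  by move=> l2x; apply: contraNN => xl1; rewrite (x12 x) // e_sym.
case al: (e a l); case bl: (e b l); case cl: (e c l); case dl: (e d l) => //=;
  first [have ll := l1ab al bl; have := off2 c l2c co; have := off2 d l2d d_o;
           by rewrite -ll ?cl ?dl
        |have ll := l2cd cl dl; have := off1 a l1a ao; have := off1 b l1b bo;
           by rewrite -ll ?al ?bl].
Qed.

Lemma build_plane (x0 : T) : proj_plane_incidence_graph e D.-1.
Proof.
exists f; split=> //.
- move=> p1 p2 f1 f2 p12; rewrite -(card_common _ p12) ?f1 ?f2 //.
  apply: eq_card => u; rewrite !inE.
  by have [/e_bip|] := boolP (e p1 u); rewrite ?andbF // f1; case: (f u).
- move=> l1 l2 f1 f2 l12; rewrite -(card_common _ l12) ?(negPf f1) ?(negPf f2) //.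
  apply: eq_card => u; rewrite !inE !(e_sym u).
  by have [/e_bip|] := boolP (e l1 u); rewrite ?andbF // (negPf f1); case: (f u).
- by have [p [fp pi p2]] := quadrangle x0; exists p.
- move=> l fl; rewrite prednK; last by lia.
  rewrite -(regular e_sym D_ge3 deg_le gram_pos l).
  apply: eq_card => u; rewrite !inE e_sym.
  by have [/e_bip|] := boolP (e l u); rewrite ?andbF // (negPf fl); case: (f u).
Qed.

End BuildPlane.

(** * Hermitian matrices with eigenvalues bounded away from 0 *)

Section HermitianLowerBound.
Local Open Scope sesquilinear_scope.
Variable C : numClosedFieldType.

Definition sqnorm n (v : 'rV[C]_n) : C := \sum_j `|v 0 j| ^+ 2.

Lemma sqnormE n (v : 'rV[C]_n) : sqnorm v = (v *m v^t*) 0 0.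
Proof. by rewrite mxE; apply: eq_bigr => j _; rewrite !mxE normCK. Qed.

Lemma sqnorm_unitary n (v : 'rV[C]_n) (P : 'M[C]_n) :
  P \is unitarymx -> sqnorm (v *m P) = sqnorm v.
Proof.
move=> /unitarymxP PP; rewrite !sqnormE trmx_mul map_mxM /= mulmxA.
by rewrite -(mulmxA v) PP mulmx1.
Qed.

(** In an orthonormal eigenbasis both sides are weighted sums of the squared moduli of the
    coordinates [y]; a nonzero coordinate makes the inequality strict. *)
Lemma hermitian_lower_bound n (A : 'M[C]_n) (c : C) (v : 'rV[C]_n) :
  A \is hermsymmx -> (forall a, eigenvalue A a -> c < `|a| ^+ 2) -> v != 0 ->
  c * sqnorm v < sqnorm (v *m A).
Proof.
move=> Aherm ev v0.
have Psp := orthomx_spectralP (hermitian_normalmx Aherm).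
have Pu := spectral_unitarymx A; have Pi := spectral_unit A.
set P := spectralmx A in Psp Pu Pi; set d := spectral_diag A in Psp.
have Pu' : invmx P \is unitarymx.
  by rewrite invmx_unitary // trmxC_unitary.
pose y := v *m invmx P.
have PA : P *m A = diag_mx d *m P by rewrite [A in LHS]Psp !mulmxA mulmxV // mul1mx.
have ed j : c < `|d 0 j| ^+ 2.
  apply/ev/eigenvalueP; exists (row j P); last first.
    apply: contraTneq Pi => rj; apply/negP => /mulmxV /(congr1 (row j)).
    by rewrite row_mul rj mul0mx row1 => /rowP/(_ j)/eqP; rewrite !mxE !eqxx eq_sym oner_eq0.
  by rewrite -row_mul PA row_mul row_diag_mx -scalemxAl -rowE.
have y0 : y != 0.
  apply: contra_neq v0 => y0.
  by rewrite -[v](mulmxKV Pi) -/y y0 mul0mx.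
rewrite -(sqnorm_unitary v Pu') -/y [A]Psp !mulmxA -/y sqnorm_unitary //.
clearbody y; rewrite /sqnorm mulr_sumr.
have [j yj] : exists j, y 0 j != 0 by apply/rV0Pn.
rewrite [ltLHS](bigD1 j) // [ltRHS](bigD1 j) //=; apply: ltr_leD.
  by rewrite mul_mx_diag mxE normrM exprMn mulrC ltr_pM2l ?exprn_gt0 ?normr_gt0.
apply: ler_sum => i _; rewrite mul_mx_diag mxE normrM exprMn mulrC.
by rewrite ler_wpM2l ?exprn_ge0 // ltW.
Qed.

End HermitianLowerBound.

(** * Symmetric matrices over a real closed field *)

Section Spectrum.
Import complex.
Local Open Scope complex_scope.
Variable R : rcfType.

(** The matrix is viewed over the complex extension of [R]; its eigenvalues there are still the
    members of [s], since the characteristic polynomial splits over [R]. *)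
Lemma symmetric_lower_bound n (A : 'M[R]_n) (s : seq R) (c : R) (v : 'rV[R]_n) :
  A^T = A -> char_poly A = \prod_(x <- s) ('X - x%:P) ->
  (forall x, x \in s -> c < x ^+ 2) -> v != 0 ->
  c * \sum_j v 0 j ^+ 2 < \sum_j (v *m A) 0 j ^+ 2.
Proof.
move=> At As cs v0; pose AC := map_mx (real_complex R) A.
have real_C (x : R) : x%:C \is Num.real.
  by apply/CrealP; apply: conjc_real.
have sq (w : 'rV[R]_n) : sqnorm (map_mx (real_complex R) w) = (\sum_j w 0 j ^+ 2)%:C.
  rewrite rmorph_sum; apply: eq_bigr => j _.
  by rewrite mxE real_normK // rmorphXn.
rewrite -ltcR rmorphM /= -!sq map_mxM.
apply: hermitian_lower_bound.
- apply: realsym_hermsym; last by apply/mxOverP => i j; rewrite mxE; apply: real_C.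
  by apply/is_hermitianmxP; rewrite expr0 scale1r map_mx_id //; apply/matrixP=> i j;
    rewrite !mxE -[A in LHS]At mxE.
- move=> a; rewrite eigenvalue_root_char -map_char_poly As.
  rewrite rmorph_prod /= (eq_bigr (fun x => 'X - x%:C%:P)); last first.
    by move=> x _; rewrite rmorphB /= map_polyX map_polyC.
  rewrite -(big_map (real_complex R) predT (fun x => 'X - x%:P)) root_prod_XsubC.
  by case/mapP => x /cs cx ->; rewrite real_normK // -rmorphXn /= ltcR.
- by rewrite map_mx_eq0.
Qed.

End Spectrum.

(** * The spectrum of a bipartite graph and its HL-index *)

Section Adjacency.
Variables (R : rcfType) (T : finType) (e : rel T) (s : seq R).
Hypothesis e_sym : symmetric e.
Hypothesis char_s : char_poly (adj_mx R e) = \prod_(x <- s) ('X - x%:P).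

Lemma sum_enum_val (F : T -> R) : \sum_(j < #|T|) F (enum_val j) = \sum_p F p.
Proof. by rewrite [RHS](reindex _ (onW_bij _ (@enum_val_bij T))). Qed.

Lemma sqr_adj (x : T -> R) :
  \sum_j ((\row_i x (enum_val i)) *m adj_mx R e) 0 j ^+ 2 =
  \sum_p \sum_q x p * x q * #|common e p q|%:R.
Proof.
rewrite (eq_bigr (fun j => (\sum_p x p * (e p (enum_val j))%:R) ^+ 2)); last first.
  move=> j _; rewrite mxE -sum_enum_val; congr (_ ^+ 2).
  by apply: eq_bigr => i _; rewrite !mxE.
rewrite (sum_enum_val (fun u => (\sum_p x p * (e p u)%:R) ^+ 2)).
rewrite (eq_bigr (fun u => \sum_p \sum_q x p * x q * (e p u && e q u)%:R)).
  rewrite exchange_big; apply: eq_bigr => p _; rewrite exchange_big.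
  apply: eq_bigr => q _; rewrite -mulr_sumr; congr (_ * _).
  rewrite -sum1_card natr_sum [RHS]big_mkcond; apply: eq_bigr => u _.
  by rewrite inE; case: (_ && _).
move=> u _; rewrite expr2 mulr_suml; apply: eq_bigr => p _; rewrite mulr_sumr.
by apply: eq_bigr => q _; rewrite mulrACA -natrM mulnb.
Qed.

Lemma adj_mx_sym : (adj_mx R e)^T = adj_mx R e.
Proof. by apply/matrixP => i j; rewrite !mxE e_sym. Qed.

Lemma common_lower_bound (c : R) (x : T -> R) p :
  (forall y, y \in s -> c < y ^+ 2) -> x p != 0 ->
  c * \sum_p x p ^+ 2 < \sum_p \sum_q x p * x q * #|common e p q|%:R.
Proof.
move=> cs xp; rewrite -sqr_adj -sum_enum_val.
rewrite (eq_bigr (fun j => ((\row_i x (enum_val i)) 0 j) ^+ 2)) => [|j _]; last by rewrite mxE.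
apply: symmetric_lower_bound adj_mx_sym char_s cs _.
by apply/rV0Pn; exists (enum_rank p); rewrite mxE enum_rankK.
Qed.

Lemma eigenfunction y : y \in s -> exists (x : T -> R) p, x p != 0 /\
  y ^+ 2 * \sum_p x p ^+ 2 = \sum_p \sum_q x p * x q * #|common e p q|%:R.
Proof.
rewrite -root_prod_XsubC -char_s -eigenvalue_root_char => /eigenvalueP[v vA v0].
pose x p := v 0 (enum_rank p).
have vE : \row_i x (enum_val i) = v.
  by apply/rowP => j; rewrite mxE /x enum_valK.
have [j vj] := rV0Pn v v0.
exists x, (enum_val j); split; first by rewrite /x enum_valK.
rewrite -sqr_adj vE vA -sum_enum_val mulr_sumr; apply: eq_bigr => i _.
by rewrite mxE exprMn /x enum_valK.
Qed.

Lemma posdef_gram D : (forall y, y \in s -> (D - 2)%:R < y ^+ 2) ->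
  posdef (gram e D) setT.
Proof.
move=> Ds x x0 _; have [p xp] : exists p, x p != 0.
  apply/existsP; apply: contra_neqT x0 => /existsPn z.
  by apply/ffunP => p; rewrite ffunE; apply/eqP/negbNE/z.
have := @common_lower_bound _ (fun p => (x p)%:~R) p Ds.
rewrite intr_eq0 => /(_ xp); rewrite -subr_gt0 -(ltr0z R); congr (_ < _).
rewrite /bform rmorph_sum mulr_sumr -sumrB; apply: eq_bigr => q0 _.
rewrite rmorph_sum [in RHS](bigD1 q0) //= [in LHS](bigD1 q0) //= addrAC.
congr (_ + _).
  by rewrite /gram eqxx mul1r !rmorphM rmorphB /= -!pmulrn; ring.
apply: eq_bigr => q /negPf pq.
by rewrite /gram eq_sym pq mul0r subr0 !rmorphM /= -pmulrn.
Qed.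

Lemma size_spectrum : size s = #|T|.
Proof. by apply/eqP; rewrite -eqSS -(size_prod_XsubC s id) -char_s size_char_poly. Qed.

(** Changing signs on one part conjugates A into -A, so the characteristic polynomial is even or
    odd. *)
Lemma bipartite_spectrum (f : T -> bool) : (forall x y, e x y -> f x != f y) ->
  perm_eq s (map -%R s).
Proof.
move=> ef; apply: prod_XsubC_eq; rewrite big_map -char_s.
pose A := adj_mx R e; pose sg (i : 'I_#|T|) : {poly R} := (-1) ^+ (f (enum_val i)).
pose S := diag_mx (\row_i sg i).
have sg2 i : sg i * sg i = 1 by rewrite /sg -expr2 sqrr_sign.
have detS : \det S * \det S = 1.
  rewrite -det_mulmx mulmx_diag (_ : diag_mx _ = 1%:M) ?det1 //.
  apply/matrixP => i j; rewrite !mxE; case: (i == j) => //.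
  by rewrite !mulr1n sg2.
(* The conjugate of X I - A is X I + A, written as minus the result of substituting -X in X I -
   A. *)
have conjS : S *m char_poly_mx A *m S = - map_mx (comp_poly (- 'X)) (char_poly_mx A).
  apply/matrixP => i j; rewrite mul_mx_diag mul_diag_mx !mxE.
  rewrite rmorphB /= comp_polyC opprB.
  have [<-|ij] := eqVneq i j.
    rewrite !mulr1n comp_polyX mulrAC sg2 mul1r opprK addrC.
    have -> : e (enum_val i) (enum_val i) = false.
      by apply/negP => /ef; rewrite eqxx.
    by rewrite !polyC0 oppr0.
  rewrite !mulr0n comp_poly0 sub0r subr0.
  have [/ef fij|_] := boolP (e _ _); last by rewrite polyC0 oppr0 mulr0 mul0r.
  by rewrite /sg; move: fij; case: (f _); case: (f _) => // _; rewrite polyC1 ?expr0 ?expr1; ring.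
have := congr1 determinant conjS.
rewrite !det_mulmx mulrAC detS mul1r -scaleN1r detZ det_map_mx -/(char_poly A).
move=> {1}->; rewrite char_s -size_spectrum rmorph_prod /=.
elim: (s) => [|x r IHr]; first by rewrite !big_nil mulr1.
rewrite !big_cons -IHr /= exprS rmorphB /= comp_polyX comp_polyC polyCN; ring.
Qed.

End Adjacency.

(** Reversing the sorted list negates it, so the two middle entries are opposite and the first of
    them is nonnegative; no entry lies strictly between them. *)
Lemma HL_of_symmetric (R : rcfType) (s : seq R) : sorted >=%R s ->
  perm_eq s (map -%R s) -> (0 < size s)%N ->
  exists2 x, x \in s & HL_of (size s) s = `|x| /\ forall y, y \in s -> `|x| <= `|y|.
Proof.
move=> sorted_s perm_s s_gt0; set n := size s in s_gt0 *.
have sE : s = rev (map -%R s).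
  apply: (sorted_eq (leT := >=%R)) => //.
  - exact: ge_trans.
  - exact: ge_anti.
  - rewrite rev_sorted sorted_map; apply: sub_sorted sorted_s => x y /=.
    by rewrite lerN2.
  - by rewrite perm_sym perm_rev perm_sym.
have nthN i : (i < n)%N -> s`_i = - s`_(n - i.+1).
  move=> lt; rewrite {1}sE nth_rev size_map // (nth_map 0) //.
  by rewrite -/n; lia.
have mono i j : (i <= j)%N -> (j < n)%N -> s`_j <= s`_i.
  move=> ij jn; apply: (sorted_leq_nth (leT := >=%R)) => //; rewrite ?inE //.
  - exact: ge_trans.
  - exact: lexx.
  - by rewrite -/n; lia.
pose a := (n.+1./2).-1; pose b := (n.+2./2).-1.
have [bn an] : (b < n)%N /\ (a < n)%N by rewrite /a /b; lia.
have ab : s`_a = - s`_b by rewrite (nthN a an) (_ : n - a.+1 = b)%N // /a /b; lia.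
have ba : s`_b <= s`_a by apply: mono => //; rewrite /a /b; lia.
exists s`_a; first exact: mem_nth.
split; first by rewrite /HL_of -/a -/b ab normrN maxxx.
move=> y /(nthP 0)[i ilt <-].
have a0 : 0 <= s`_a by lra.
rewrite (ger0_norm a0); have [ia|ia] := leqP i a.
  by apply: le_trans (mono _ _ ia an) (ler_norm _).
have ib : (b <= i)%N by move: ia; rewrite /a /b; lia.
rewrite ab lerNl; apply: le_trans (mono _ _ ib ilt).
by rewrite lerNnormlW.
Qed.

(** * Degrees and the quadratic form of a projective plane *)

Section PlaneDegrees.
Variables (T : finType) (e : rel T) (f : T -> bool) (q : nat).
Hypothesis e_sym : symmetric e.
Hypothesis e_bip : forall x y, e x y -> f x != f y.
Hypothesis join_points : forall p1 p2, f p1 -> f p2 -> p1 != p2 ->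
  #|[set l | ~~ f l & e p1 l && e p2 l]| = 1%N.
Hypothesis meet_lines : forall l1 l2, ~~ f l1 -> ~~ f l2 -> l1 != l2 ->
  #|[set p | f p & e p l1 && e p l2]| = 1%N.
Hypothesis quad : exists p : 'I_4 -> T, (forall i, f (p i)) /\ injective p /\
  forall l, ~~ f l -> (#|[set i | e (p i) l]| <= 2)%N.
Hypothesis line_size : forall l, ~~ f l -> #|[set p | f p & e p l]| = q.+1.

Lemma plane_common x y : x != y -> #|common e x y| = (f x == f y).
Proof.
move=> xy; have [fxy|fxy] := eqVneq (f x) (f y); last first.
  apply/eqP; rewrite cards_eq0; apply/eqP/setP => u; rewrite !inE.
  by apply/negP => /andP[/e_bip + /e_bip]; move: fxy; case: (f x) (f y) (f u) => [] [] [].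
case fx: (f x) fxy => fy.
  rewrite -[RHS]/1%N -(join_points fx (esym fy) xy); apply: eq_card => u; rewrite !inE.
  by have [/e_bip|] := boolP (e x u); rewrite ?andbF // fx; case: (f u).
rewrite -[RHS]/1%N -(meet_lines (negbT fx) (negbT (esym fy)) xy); apply: eq_card => u; rewrite !inE.
rewrite !(e_sym u).
by have [/e_bip|] := boolP (e x u); rewrite ?andbF // fx; case: (f u).
Qed.

Lemma degree_line l : ~~ f l -> degree e l = q.+1.
Proof.
move=> fl; rewrite -(line_size fl); apply: eq_card => u; rewrite !inE e_sym.
by have [/e_bip|] := boolP (e u l); rewrite ?andbF // (negPf fl); case: (f u).
Qed.

Lemma plane_line x y : f x -> f y -> x != y -> exists l, [/\ ~~ f l, e x l & e y l].
Proof.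
move=> fx fy xy; have /eqP/cards1P[l] := join_points fx fy xy.
by move=> /setP/(_ l); rewrite !inE eqxx => /and3P[]; exists l.
Qed.

(** If all lines passed through [p], the lines joining a corner other than [p] to two further
    corners would share two points and coincide, with three corners on one line. *)
Lemma line_avoiding p : f p -> exists l, ~~ f l /\ ~~ e p l.
Proof.
move=> fp; case: (pickP (fun l => ~~ f l && ~~ e p l)) => [l /andP[]|none].
  by exists l.
have all_p l : ~~ f l -> e p l by move=> fl; have := none l; rewrite fl => /negbFE.
have [x [fx [xinj x2]]] := quad.
have [i [j [k [ij ik jk xip]]]] : exists i j k, [/\ i != j, i != k, j != k & x i != p].
  have [x0|x0] := eqVneq (x 0) p.
    exists 1, (1 + 1), 0; split=> //; rewrite -x0.
    by apply/eqP => /xinj.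
  by exists 0, 1, (1 + 1); split.
have [l [fl il jl]] := plane_line (fx i) (fx j) (contra_neq (@xinj i j) ij).
have [m [fm im km]] := plane_line (fx i) (fx k) (contra_neq (@xinj i k) ik).
have lm : l = m.
  have /card_le1_eqP : (#|common e (x i) p| <= 1)%N by rewrite plane_common // leq_b1.
  by apply; rewrite inE ?il ?im all_p.
have := x2 l fl; have : [set i; j; k] \subset [set i | e (x i) l].
  apply/subsetP => t; rewrite !inE -orbA => /or3P[] /eqP-> //.
  by rewrite lm.
by move/subset_leq_card; rewrite -setUA cardsU1 cards2 !inE negb_or ij ik jk => /leq_trans h /h.
Qed.

(** The axioms prescribe the size of lines only. The q + 1 points of a line missing the point [p]
    are joined to [p] by different lines. *)
Lemma degree_ge p : (q < degree e p)%N.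
Proof.
have [fp|fp] := boolP (f p); last by rewrite degree_line.
have [l [fl pl]] := line_avoiding fp.
rewrite -(line_size fl).
pose g y := odflt l [pick u | e p u && e y u].
have gP y : f y -> e y l -> e p (g y) && e y (g y).
  move=> fy yl; have py : p != y by apply: contraNneq pl => ->.
  have [u [_ pu yu]] := plane_line fp fy py.
  by rewrite /g; case: pickP => [//|/(_ u)]; rewrite pu yu.
rewrite -(@card_in_imset _ _ g) => [|y z]; rewrite ?inE.
  apply/subset_leq_card/subsetP => _ /imsetP[y + ->]; rewrite !inE => /andP[fy yl].
  by have /andP[] := gP y fy yl.
move=> /andP[fy yl] /andP[fz zl] gyz; apply/eqP; apply: contraNT pl => yz.
have /andP[pg yg] := gP y fy yl; have /andP[_] := gP z fz zl; rewrite -gyz => zg.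
have /card_le1_eqP : (#|common e y z| <= 1)%N by rewrite plane_common // leq_b1.
by move=> H; rewrite (_ : l = g y) //; apply: H; rewrite inE ?yl ?yg.
Qed.

Hypothesis degree_le : forall p, (degree e p <= q.+1)%N.

Lemma plane_common_all x y : #|common e x y| = ((x == y) * q + (f x == f y))%N.
Proof.
have [<-|xy] := eqVneq x y; last by rewrite plane_common // mul0n.
rewrite eqxx mul1n addn1; apply/eqP; rewrite eqn_leq; apply/andP.
have -> : #|common e x x| = degree e x.
  by apply: eq_card => u; rewrite !inE andbb.
by rewrite degree_le degree_ge.
Qed.

(** A^2 is q I plus the all-ones matrix on each part. *)
Lemma plane_form (R : rcfType) (x : T -> R) :
  \sum_p \sum_r x p * x r * #|common e p r|%:R =
  q%:R * \sum_p x p ^+ 2 + (\sum_(p | f p) x p) ^+ 2 + (\sum_(p | ~~ f p) x p) ^+ 2.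
Proof.
have sq (P : pred T) : (\sum_(p | P p) x p) ^+ 2 =
    \sum_p \sum_r x p * x r * (P p && P r)%:R.
  rewrite expr2 mulr_suml big_mkcond; apply: eq_bigr => p _.
  rewrite mulr_sumr big_mkcond; case: (P p); last first.
    by rewrite big1 // => r _; rewrite mulr0.
  by apply: eq_bigr => r _; case: (P r); rewrite ?mulr1 ?mulr0.
rewrite !sq mulr_sumr -!big_split; apply: eq_bigr => p _ /=.
rewrite (_ : q%:R * x p ^+ 2 = \sum_r x p * x r * ((p == r) * q)%N%:R); last first.
  rewrite (bigD1 p) //= eqxx mul1n big1 ?addr0; first by ring.
  by move=> r; rewrite eq_sym => /negPf->; rewrite mulr0.
rewrite -!big_split; apply: eq_bigr => r _ /=; rewrite plane_common_all.
by rewrite -!mulrDr -!natrD; congr (_ * _%:R); case: (f p) (f r) => [] [] /=; lia.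
Qed.

Lemma two_lines : exists l m, [/\ ~~ f l, ~~ f m & l != m].
Proof.
have [x [fx [xinj _]]] := quad.
have x01 : x 0 != x 1 by apply/eqP => /xinj.
have [l [fl xl yl]] := plane_line (fx 0) (fx 1) x01.
have [m [fm xm]] := line_avoiding (fx 0).
by exists l, m; split=> //; apply: contraNneq xm => <-.
Qed.

End PlaneDegrees.

Unset Implicit Arguments.

Theorem theorem2p4 (R : rcfType) (T : finType) (e : rel T) (Delta : nat) :
  simple_graph e -> connected_graph e -> bipartite e ->
  max_degree e = Delta -> (3 <= Delta)%N ->
  forall s : seq R, sorted_spectrum (adj_mx R e) s ->
    (~ proj_plane_incidence_graph e Delta.-1 ->
       HL_of #|T| s <= Num.sqrt (Delta - 2)%:R) /\
    (proj_plane_incidence_graph e Delta.-1 ->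
       HL_of #|T| s = Num.sqrt (Delta - 1)%:R).
Proof.
move=> [e_sym _] conn [f ef] maxD D3 s [sorted_s char_s].
have deg_le p : (degree e p <= Delta)%N by rewrite -maxD; apply: leq_bigmax.
have [x0 _] : exists x0 : T, true.
  case: (pickP (fun _ : T => true)) => [x0 _|T0]; first by exists x0.
  by move: D3; rewrite -maxD /max_degree big1 // => x; have := T0 x.
have size_s := size_spectrum char_s.
have [y ys [HLy y_min]] : exists2 y, y \in s &
    HL_of (size s) s = `|y| /\ forall z, z \in s -> `|y| <= `|z|.
  apply: HL_of_symmetric sorted_s (bipartite_spectrum char_s ef) _.
  by rewrite size_s; apply/card_gt0P; exists x0.
rewrite -size_s HLy; split=> [not_plane|[g [eg join meet quad lines]]].
  (* As [y] has the least modulus, all squared eigenvalues exceed Delta - 2, which makes [gram]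
     positive definite. *)
  rewrite leNgt; apply/negP => lt_y; apply: not_plane.
  apply: (build_plane e_sym D3 deg_le _ conn ef x0).
  apply: (posdef_gram e_sym char_s) => z /y_min yz.
  rewrite -real_normK ?num_real // -[X in X < _]sqr_sqrtr ?ler0n //.
  by rewrite ltr_pXn2r ?nnegrE ?sqrtr_ge0 // (lt_le_trans lt_y).
pose q := Delta.-1; have qD : q.+1 = Delta by rewrite /q; lia.
have deg_le' p : (degree e p <= q.+1)%N by rewrite qD.
have form := plane_form e_sym eg join meet quad lines deg_le'.
suff y2 : y ^+ 2 = q%:R by rewrite -sqrtr_sqr y2 /q subn1.
apply/eqP; rewrite eq_le; apply/andP; split.
  have [l [m [fl fm lm]]] := two_lines e_sym eg join meet quad.
  rewrite leNgt; apply/negP => q_lt.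
  (* Both linear forms in [plane_form] vanish on this difference of two lines, so equality holds
     where [common_lower_bound] would be strict. *)
  pose x (p : T) : R := (p == l)%:R - (p == m)%:R.
  have q_lt_s z : z \in s -> q%:R < z ^+ 2.
    move=> /y_min yz; apply: lt_le_trans q_lt _.
    by rewrite -[leLHS]real_normK ?num_real // -[leRHS]real_normK ?num_real // lerXn2r ?nnegrE.
  have xl : x l != 0 by rewrite /x eqxx (negPf lm) subr0 oner_eq0.
  have := common_lower_bound e_sym char_s q_lt_s xl; rewrite form.
  have sumP (P : pred T) : \sum_(p | P p) x p = (P l)%:R - (P m)%:R.
    have sum1P a : \sum_(p | P p) (p == a)%:R = (P a)%:R :> R.
      rewrite big_mkcond (bigD1 a) //= eqxx big1 => [|r /negPf->].
        by rewrite addr0; case: (P a).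
      by case: (P r).
    by rewrite sumrB !sum1P.
  by rewrite !sumP fl fm (negPf fl) (negPf fm) !subrr expr0n /= !addr0 ltxx.
(* At an eigenvector for [y] the two squares in [plane_form] are nonnegative, whence [y ^+ 2] is at
   least q. *)
have [x [p [xp]]] := eigenfunction char_s ys; rewrite form => form_eq.
have norm_gt0 : 0 < \sum_p x p ^+ 2.
  rewrite (bigD1 p) //= ltr_pwDl ?exprn_even_gt0 //.
  by apply: sumr_ge0 => r _; apply: sqr_ge0.
by rewrite -(ler_pM2r norm_gt0) form_eq -addrA lerDl addr_ge0 ?sqr_ge0.
Qed.
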